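(* Consider the $\ell_p$-norm RSA iteration described in the context, with $p\ge1$ and $\lambda>0$, and let $b$ satisfy $\frac1b+\frac1p=1$. Suppose that: (1) for every worker $i$ the local cost $\tilde x\mapsto\mathbb{E}[F(\tilde x,\xi_i)]$ is strongly convex with constant $\mu_i>0$, and $f_0$ is strongly convex with constant $\mu_0>0$; (2) for every worker $i$ the local cost $\tilde x\mapsto\mathbb{E}[F(\tilde x,\xi_i)]$ has Lipschitz continuous gradient with constant $L_i$, and $f_0$ has Lipschitz continuous gradient with constant $L_0$; (3) for every worker $i$ the data sampling is i.i.d. across time with $\xi_i^k\sim\mathcal{D}_i$, and the variance of $\nabla F(\tilde x,\xi_i)$ is bounded by $\delta_i^2$, namely $\mathbb{E}\big[\|\nabla\mathbb{E}[F(\tilde x,\xi_i)]-\nabla F(\tilde x,\xi_i)\|^2\big]\le\delta_i^2$. Let $\epsilon\in\big(0,\frac{2\mu_0L_0}{\mu_0+L_0}\big)$ be any constant, and set $$\eta=\min\Big\{\min_{i\in\mathcal{R}}\frac{2\mu_iL_i}{\mu_i+L_i},\ \frac{2\mu_0L_0}{\mu_0+L_0}-\epsilon\Big\},\qquad \underline{\alpha}=\min\Big\{\min_{i\in\mathcal{R}}\frac{1}{2(\mu_i+L_i)},\ \frac{1}{2(\mu_0+L_0)}\Big\},\qquad \overline{\alpha}>\frac1\eta ,$$ and take step sizes $\alpha^{k+1}=\min\{\underline{\alpha},\frac{\overline{\alpha}}{k+1}\}$ for $k\ge0$. Let $k_0$ be the smallest (nonnegative) integer with $\underline{\alpha}\ge\frac{\overline{\alpha}}{k_0+1}$.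 Define $$\Delta_0=16\lambda^2rd+16\lambda^2r^2d+2\lambda^2q^2d+2\sum_{i\in\mathcal{R}}\delta_i^2,\qquad \Delta_2=\frac{\lambda^2q^2d}{\epsilon},$$ $$\Delta_1=\max\Big\{\frac{\overline{\alpha}^2\Delta_0}{\eta\overline{\alpha}-1},\ (k_0+1)\,\mathbb{E}\|x^{k_0}-x^*\|^2+\frac{\overline{\alpha}^2\Delta_0}{k_0+1}\Big\},$$ and $\lambda_0=\max_{i\in\mathcal{R}}\|\nabla\mathbb{E}[F(\tilde x^*,\xi_i)]\|_b$. (a) If $\lambda\ge\lambda_0$, then for a sufficiently large $k\ge k_0$, $$\mathbb{E}\|x^k-[\tilde x^*]\|^2\le\frac{\Delta_1}{k+1}+\overline{\alpha}\Delta_2 .$$ (b) If $0<\lambda<\lambda_0$, and the difference between the two optimizers is bounded by $\|x^*-[\tilde x^*]\|^2\le\Delta_3$, then for $k\ge k_0$, $$\mathbb{E}\|x^k-[\tilde x^*]\|^2\le\frac{2\Delta_1}{k+1}+2\overline{\alpha}\Delta_2+2\Delta_3 .$$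
   Context: Setting. There are a master and $m$ workers, partitioned into a set $\mathcal{R}$ of regular workers, $|\mathcal{R}|=r=m-q$, and a set $\mathcal{B}$ of Byzantine workers, $|\mathcal{B}|=q$. For each worker $i$, $\xi_i$ is a random variable with distribution $\mathcal{D}_i$ (the distributions may differ across workers) and $F(\tilde x,\xi_i)$ is its loss function, $\tilde x\in\mathbb{R}^d$, with $\nabla$ denoting the gradient in $\tilde x$. $f_0:\mathbb{R}^d\to\mathbb{R}$ is a regularization term. $\|\cdot\|$ is the Euclidean norm, $\|\cdot\|_p$ the $\ell_p$ norm on $\mathbb{R}^d$ (with $b=\infty$ when $p=1$). Optimization problems. The target is $$\tilde x^*=\arg\min_{\tilde x\in\mathbb{R}^d}\ \sum_{i\in\mathcal{R}}\mathbb{E}[F(\tilde x,\xi_i)]+f_0(\tilde x).$$ $x=[x_i;x_0]\in\mathbb{R}^{(r+1)d}$ stacks $x_i\in\mathbb{R}^d$ ($i\in\mathcal{R}$) and $x_0\in\mathbb{R}^d$, and the regularized problem has solution $$x^*=\arg\min_{x=[x_i;x_0]}\ \sum_{i\in\mathcal{R}}\Big(\mathbb{E}[F(x_i,\xi_i)]+\lambda\|x_i-x_0\|_p\Big)+f_0(x_0).$$ $[\tilde x^*]\in\mathbb{R}^{(r+1)d}$ is the stack of $r+1$ copies of $\tilde x^*$. $\ell_p$-norm RSA iteration. Starting from initial iterates $x_i^0$ ($i\in\mathcal{R}$) and $x_0^0$, for $k\ge0$: $$x_i^{k+1}=x_i^k-\alpha^{k+1}\big(\nabla F(x_i^k,\xi_i^k)+\lambda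 s_i^k\big),\quad i\in\mathcal{R},$$ $$x_0^{k+1}=x_0^k-\alpha^{k+1}\Big(\nabla f_0(x_0^k)+\lambda\Big(\sum_{i\in\mathcal{R}}w_i^k+\sum_{j\in\mathcal{B}}t_j^k\Big)\Big),$$ where $s_i^k$ is a subgradient of $u\mapsto\|u-x_0^k\|_p$ at $u=x_i^k$, $w_i^k$ is a subgradient of $u\mapsto\|u-x_i^k\|_p$ at $u=x_0^k$, and $t_j^k$ is a subgradient of $u\mapsto\|u-z_j^k\|_p$ at $u=x_0^k$. Here $\xi_i^k$ is the sample drawn by regular worker $i$ at time $k$, and $z_j^k\in\mathbb{R}^d$ is an arbitrary vector sent to the master by the Byzantine worker $j\in\mathcal{B}$. $x^k=[x_i^k;x_0^k]\in\mathbb{R}^{(r+1)d}$ denotes the stacked iterates.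
   Formalization: Added: [s_i^k; sum_i w_i^k] is jointly a subgradient of sum_i ||x_i-x_0||_p at x^k (e.g. w_i^k=-s_i^k); with independent choices at kinks the claim fails. Samples at time k are independent of the past; chosen subgradients do not use future samples. *)

(* Defs.v *)
From HB Require Import structures.
From mathcomp Require Import all_boot all_order all_algebra.
From mathcomp Require Import all_classical all_reals all_analysis.

Set Implicit Arguments.
Unset Strict Implicit.
Unset Printing Implicit Defensive.

Import Order.TTheory GRing.Theory Num.Theory.
Import numFieldNormedType.Exports.

Local Open Scope classical_set_scope.
Local Open Scope ring_scope.

Section Vectors.
Context {R : realType} {d : nat}.
Implicit Types (f h : 'rV[R]_d -> R) (u v x y g : 'rV[R]_d).

Definition dotp u v : R := \sum_(j < d) u 0 j * v 0 j.

(* The library norm on 'rV[R]_d is the sup norm; this is the Euclidean one. *)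
Definition enorm v : R := Num.sqrt (\sum_(j < d) v 0 j ^+ 2).

Definition lpnorm (p : \bar R) v : R :=
  match p with
  | r%:E => (\sum_(j < d) `|v 0 j| `^ r) `^ r^-1
  | +oo%E => \big[Num.max/0]_(j < d) `|v 0 j|
  | -oo%E => 0
  end.

Definition gradient f x : 'rV[R]_d := \row_(j < d) 'D_(delta_mx 0 j) f x.

Definition is_subgradient h u g : Prop :=
  forall v, h u + dotp g (v - u) <= h v.

Definition strongly_convex (mu : R) f : Prop :=
  forall x y (t : R), 0 <= t <= 1 ->
    f (t *: x + (1 - t) *: y) <=
      t * f x + (1 - t) * f y - mu / 2 * t * (1 - t) * enorm (x - y) ^+ 2.

Definition lipschitz_gradient (L : R) f : Prop :=
  (forall x, differentiable f x) /\
  forall x y, enorm (gradient f x - gradient f y) <= L * enorm (x - y).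

End Vectors.

(* A stacked vector [x_i; x_0] is a family x : 'I_m -> 'rV_d, of which only the
   components indexed by the set I of regular workers are used, with x0. *)
Section Stacks.
Context {R : realType} {d m : nat} (I : {set 'I_m}).
Implicit Types (x y s w : 'I_m -> 'rV[R]_d).

Definition stack_sqdist x (x0 : 'rV[R]_d) y (y0 : 'rV[R]_d) : R :=
  \sum_(i in I) enorm (x i - y i) ^+ 2 + enorm (x0 - y0) ^+ 2.

Definition consensus_penalty (p : \bar R) x (x0 : 'rV[R]_d) : R :=
  \sum_(i in I) lpnorm p (x i - x0).

(* [s_i; \sum_i w_i] is a subgradient of the whole penalty at [x_i; x_0].
   Partial subgradients s_i and w_i in x_i and in x_0 have this property
   whenever each norm is differentiable at x_i - x_0, and in general as soon as
   w_i = - s_i. At a kink (e.g. x_i = x_0), partial subgradients selected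
   independently of each other may fail to have it. *)
Definition is_stack_subgradient (p : \bar R) x (x0 : 'rV[R]_d) s w : Prop :=
  forall y (y0 : 'rV[R]_d),
    consensus_penalty p x x0
      + (\sum_(i in I) dotp (s i) (y i - x i)
         + dotp (\sum_(i in I) w i) (y0 - x0))
    <= consensus_penalty p y y0.

End Stacks.

Section Sampling.
Context {R : realType} {dO dX : measure_display}.
Context {Omega : measurableType dO} {Xi : measurableType dX}.
Variable P : probability Omega R.

Definition filtration (G : nat -> set (set Omega)) : Prop :=
  [/\ forall k, sigma_algebra setT (G k),
      forall k, G k `<=` measurable
    & forall k, G k `<=` G k.+1].

Definition measurable_wrt d (T : measurableType d) (H : set (set Omega))
    (X : Omega -> T) : Prop :=
  forall C, measurable C -> H (X @^-1` C).

Definition rV_measurable_wrt n (H : set (set Omega))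
    (v : Omega -> 'rV[R]_n) : Prop :=
  forall j, measurable_wrt H (fun omega => v omega 0 j).

Definition independent_of (H : set (set Omega)) (X : Omega -> Xi) : Prop :=
  forall A C, H A -> measurable C ->
    P (A `&` X @^-1` C) = (P A * P (X @^-1` C))%E.

(* G k is the history before the samples of time k are drawn. Since X l is
   G l.+1-measurable, independence of X k from G k makes the X k, k >= 0,
   mutually independent. *)
Definition iid_sampling (G : nat -> set (set Omega)) (D : probability Xi R)
    (X : nat -> Omega -> Xi) : Prop :=
  forall k,
    [/\ measurable_wrt (G k.+1) (X k),
        forall C, measurable C -> P (X k @^-1` C) = D C
      & independent_of (G k) (X k)].

End Sampling.

Section Losses.
Context {R : realType} {d : nat} {dX : measure_display}.
Context {Xi : measurableType dX}.
Variables (D : probability Xi R) (F : 'rV[R]_d -> Xi -> R).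

Definition mean_loss (x : 'rV[R]_d) : R := fine ('E_D[F x]).

Definition bounded_variance (delta : R) : Prop :=
  forall x, ('E_D[fun z => (enorm (gradient mean_loss x
                                   - gradient (F^~ z) x) ^+ 2)%R]
             <= (delta ^+ 2)%:E)%E.

End Losses.

(* Main.v *)
(** The squared distance [V_k] of the stacked iterates to the minimizer [x*] of
    the penalized problem contracts in expectation:
    [E V_(k+1) <= (1 - alpha eta) E V_k + alpha^2 Delta0 + alpha Delta2].
    First-order optimality makes [- grad / lambda] at [x*] a subgradient of the
    whole penalty, so the penalty terms contribute a nonpositive cross term;
    strong convexity and smoothness give
    [mu L |v|^2 + |a|^2 <= (mu + L) <a, v>] for gradient differences [a], which
    yields the contraction and absorbs [|a|^2]; the Byzantine term is split by
    Young's inequality with weight [epsilon].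

    Unbiasedness of the sampled gradients comes from differentiability of the
    loss and the variance bound, which is uniform in the point: the
    inequality [|phi b - phi a| <= int |phi'|], valid for every
    everywhere differentiable [phi], makes the difference quotients of the loss
    uniformly integrable, and the expectation commutes with the derivative. *)
Require Import Defs.
From HB Require Import structures.
From mathcomp Require Import all_boot all_order all_algebra.
From mathcomp Require Import all_classical all_reals all_analysis.
From mathcomp Require Import measurable_realfun ring lra.

Set Implicit Arguments.
Unset Strict Implicit.
Unset Printing Implicit Defensive.

Import Order.TTheory GRing.Theory Num.Theory.
Import numFieldNormedType.Exports.

Local Open Scope classical_set_scope.
Local Open Scope ring_scope.

(** * Euclidean and l_p norms *)

(** Only the sampling noise is averaged; every other term is bounded for each [omega]. Subgradients
    and Byzantine terms may therefore depend on the current sample, whereas the iterate paired with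
    the noise belongs to the history [G k], of which that sample is independent. The penalty has no
    sign worker by worker: its cross terms become nonnegative only when summed over the whole stack,
    which is why workers and master share one inequality. Nor do the gradients at the minimizer
    vanish individually; optimality of the stack bounds their coordinates by [lambda] and
    [lambda r], the size of the penalty subgradients. This doubling, squared, times the 4 of a split
    square, is the 16 of [Delta0]. The mean squared distance at [k0] may be infinite. [Delta1] is
    then infinite and the bound trivial; otherwise the recursion is run on real numbers. *)

Section Euclidean.
Context {R : realType} {d : nat}.
Implicit Types (u v w : 'rV[R]_d).

Lemma dotpC u v : dotp u v = dotp v u.
Proof. by apply: eq_bigr => j _; rewrite mulrC. Qed.

Lemma dotpDl u v w : dotp (u + v) w = dotp u w + dotp v w.
Proof. by rewrite -big_split/=; apply: eq_bigr => j _; rewrite mxE mulrDl. Qed.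

Lemma dotpDr u v w : dotp u (v + w) = dotp u v + dotp u w.
Proof. by rewrite dotpC dotpDl !(dotpC u). Qed.

Lemma dotpZl a u v : dotp (a *: u) v = a * dotp u v.
Proof. by rewrite mulr_sumr; apply: eq_bigr => j _; rewrite mxE mulrA. Qed.

Lemma dotpZr a u v : dotp u (a *: v) = a * dotp u v.
Proof. by rewrite dotpC dotpZl dotpC. Qed.

Lemma dotpNl u v : dotp (- u) v = - dotp u v.
Proof. by rewrite -scaleN1r dotpZl mulN1r. Qed.

Lemma dotpNr u v : dotp u (- v) = - dotp u v.
Proof. by rewrite dotpC dotpNl dotpC. Qed.

Lemma dotp0l u : dotp 0 u = 0.
Proof. by rewrite -(scale0r (0 : 'rV[R]_d)) dotpZl mul0r. Qed.

Lemma dotp0r u : dotp u 0 = 0.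
Proof. by rewrite dotpC dotp0l. Qed.

Lemma dotp_suml (I : finType) (A : {set I}) (F : I -> 'rV[R]_d) u :
  dotp (\sum_(i in A) F i) u = \sum_(i in A) dotp (F i) u.
Proof.
by elim/big_rec2: _ => [|i a b _ <-]; rewrite ?dotp0l// dotpDl.
Qed.

Definition dotpE := (dotpDl, dotpDr, dotpNl, dotpNr, dotpZl, dotpZr).

Lemma dotp_ge0 u : 0 <= dotp u u.
Proof. by apply: sumr_ge0 => j _; rewrite -expr2 sqr_ge0. Qed.

Lemma enorm_sqr u : enorm u ^+ 2 = dotp u u.
Proof.
rewrite sqr_sqrtr; first by apply: eq_bigr => j _; rewrite expr2.
by apply: sumr_ge0 => j _; exact: sqr_ge0.
Qed.

Lemma enorm_ge0 u : 0 <= enorm u.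
Proof. exact: sqrtr_ge0. Qed.

(** Expand the nonnegative square of [c *: u - v]. With a well chosen weight [c] this stands in for
    Cauchy-Schwarz below. *)
Lemma dotp_young (c : R) u v : 0 < c ->
  2 * dotp u v <= c * dotp u u + c^-1 * dotp v v.
Proof.
move=> c0; have := dotp_ge0 (c *: u - v); rewrite !dotpE (dotpC v u) => h.
have c'0 : 0 <= c^-1 by rewrite invr_ge0 ltW.
rewrite -subr_ge0; apply: le_trans (mulr_ge0 c'0 h) _.
by rewrite le_eqVlt; apply/orP; left; apply/eqP; field; rewrite gt_eqF.
Qed.

Lemma dotp_le_enorm (a : R) u v : enorm u <= a * enorm v ->
  dotp u u <= a ^+ 2 * dotp v v.
Proof.
move=> h; rewrite -!enorm_sqr -exprMn lerXn2r ?nnegrE ?enorm_ge0//.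
exact: le_trans (enorm_ge0 _) h.
Qed.

Lemma dotp_sqrD u v : dotp (u + v) (u + v) <= 2 * dotp u u + 2 * dotp v v.
Proof. by have := dotp_ge0 (u - v); rewrite !dotpE (dotpC v u); lra. Qed.

Lemma dotp_eq0 u : dotp u u = 0 -> u = 0.
Proof.
move=> /eqP; rewrite psumr_eq0; last by move=> j _; rewrite -expr2 sqr_ge0.
move=> /allP h; apply/rowP => j; rewrite mxE; apply/eqP.
by have := h j; rewrite mem_index_enum => /(_ isT)/=; rewrite mulf_eq0 orbb.
Qed.

Lemma dotp_deltal (j : 'I_d) u : dotp (delta_mx 0 j) u = u 0 j.
Proof.
rewrite /dotp (bigD1 j)//= big1 ?addr0; first by rewrite mxE !eqxx mul1r.
by move=> i ij; rewrite mxE eqxx (negPf ij) mul0r.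
Qed.

Lemma dotp_deltar (j : 'I_d) u : dotp u (delta_mx 0 j) = u 0 j.
Proof. by rewrite dotpC dotp_deltal. Qed.

(** Origin of the factor [d] in the constants: subgradients of an l_p norm are controlled coordinate
    by coordinate, uniformly in [p]. *)
Lemma dotp_le_coord (c : R) u : (forall j, `|u 0 j| <= c) ->
  dotp u u <= c ^+ 2 * d%:R.
Proof.
move=> h; rewrite mulr_natr.
suff : dotp u u <= \sum_(j < d) c ^+ 2 by rewrite sumr_const card_ord.
apply: ler_sum => j _; rewrite -expr2 -real_normK ?num_real//.
by rewrite lerXn2r ?nnegrE ?normr_ge0// (le_trans _ (h j)).
Qed.

End Euclidean.

(** * Minkowski and Hoelder inequalities, subgradients of l_p norms *)

Section LpNorm.
Context {R : realType} {d : nat}.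
Implicit Types (u v w : 'rV[R]_d) (p b : \bar R).

Lemma lpnorm_ge0 p v : 0 <= lpnorm p v.
Proof.
case: p => [r||]//=; first exact: powR_ge0.
by elim/big_ind: _ => // x y x0 y0; rewrite le_max x0.
Qed.

Lemma powR_sum_ge0 (r : R) v : 0 <= \sum_(j < d) `|v 0 j| `^ r.
Proof. by apply: sumr_ge0 => j _; exact: powR_ge0. Qed.

Lemma lpnorm_powR (r : R) v : 0 < r ->
  lpnorm r%:E v `^ r = \sum_(j < d) `|v 0 j| `^ r.
Proof.
by move=> r0; rewrite /= -powRrM mulVf ?gt_eqF// powRr1 ?powR_sum_ge0.
Qed.

Lemma lpnorm0 p : (1 <= p)%E -> lpnorm p (0 : 'rV[R]_d) = 0.
Proof.
case: p => [r||]//=; rewrite ?lee_fin => r1.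
  have r0 : r != 0 by rewrite gt_eqF// (lt_le_trans _ r1).
  rewrite big1 ?powR0 ?invr_eq0//.
  by move=> j _; rewrite mxE normr0 powR0.
by apply: big1_idem => //=; [exact: maxxx|move=> j _; rewrite mxE normr0].
Qed.

Lemma lpnormZ p (a : R) v : (1 <= p)%E -> 0 <= a ->
  lpnorm p (a *: v) = a * lpnorm p v.
Proof.
case: p => [r||]//=; rewrite ?lee_fin => r1 a0; last first.
  apply: (big_ind2 (fun x y : R => x = a * y)) => [|x1 x2 y1 y2 -> ->|j _].
  - by rewrite mulr0.
  - by rewrite maxr_pMr.
  - by rewrite mxE normrM (ger0_norm a0).
have r0 : 0 < r by rewrite (lt_le_trans _ r1).
under eq_bigr do rewrite mxE normrM (ger0_norm a0) powRM//.
rewrite -mulr_sumr powRM ?powR_ge0 ?powR_sum_ge0//.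
by rewrite -powRrM mulfV ?gt_eqF// powRr1.
Qed.

Lemma lpnormN p v : lpnorm p (- v) = lpnorm p v.
Proof.
have h j : `|(- v) 0 j| = `|v 0 j| by rewrite mxE normrN.
rewrite /lpnorm; case: p => [r||].
- by under eq_bigr do rewrite h.
- by under eq_bigr do rewrite h.
- by [].
Qed.

Lemma normr_le_lpnormy v j : `|v 0 j| <= lpnorm +oo%E v.
Proof. by rewrite /= (bigD1 j)//= le_max lexx. Qed.

Lemma lpnorm_delta p j : (1 <= p)%E -> lpnorm p (delta_mx 0 j : 'rV[R]_d) = 1.
Proof.
case: p => [r||]//=; rewrite ?lee_fin => r1.
  have r0 : r != 0 by rewrite gt_eqF// (lt_le_trans _ r1).
  rewrite (bigD1 j)//= big1 ?addr0 ?mxE ?eqxx ?normr1 ?powR1 ?powR1//.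
  by move=> i ij; rewrite mxE eqxx (negPf ij) normr0 powR0.
apply/eqP; rewrite eq_le; apply/andP; split; last first.
  by have := normr_le_lpnormy (delta_mx 0 j) j; rewrite mxE !eqxx normr1.
elim/big_ind: _ => // [x y x1 y1|i _]; first by rewrite ge_max x1.
by rewrite mxE eqxx /=; case: (i == j); rewrite ?normr1 ?normr0.
Qed.

Lemma convex_powRE (r x y t : R) : 1 <= r -> 0 <= x -> 0 <= y -> 0 <= t <= 1 ->
  (t * x + (1 - t) * y) `^ r <= t * x `^ r + (1 - t) * y `^ r.
Proof.
move=> r1 x0 y0 /andP[t0 t1].
have := @convex_powR R r r1 (Itv01 t0 t1) x y.
rewrite !inE/= !in_itv/= !andbT => /(_ x0 y0).
by rewrite !convRE/=.
Qed.

Lemma lpnorm_eq0 (r : R) v : 0 < r -> lpnorm r%:E v = 0 -> v = 0.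
Proof.
move=> r0 h; have := lpnorm_powR v r0; rewrite h powR0 ?gt_eqF// => /esym/eqP.
rewrite psumr_eq0; last by move=> j _; exact: powR_ge0.
move=> /allP hh; apply/rowP => j; rewrite mxE; apply/eqP.
have := hh j; rewrite mem_index_enum => /(_ isT)/= /eqP.
by move=> /powR_eq0_eq0/eqP; rewrite normr_eq0.
Qed.

Lemma sum_powR_normalized (c r : R) v : 0 < r -> lpnorm r%:E v = c -> 0 < c ->
  \sum_(j < d) (`|v 0 j| / c) `^ r = 1.
Proof.
move=> r0 vc c0; under eq_bigr do rewrite powRM ?invr_ge0 ?(ltW c0)//.
rewrite -mulr_suml -lpnorm_powR// vc -powRM ?invr_ge0 ?(ltW c0)//.
by rewrite mulfV ?gt_eqF// powR1.
Qed.

(** Minkowski through convexity of the power: with [a], [b] the two norms and [t = a / (a + b)],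
    each [|u_j + v_j|] is at most [a + b] times the convex combination of [|u_j| / a] and
    [|v_j| / b], and the powers of these normalized entries sum to one. *)
Lemma lpnormD p u v : (1 <= p)%E -> lpnorm p (u + v) <= lpnorm p u + lpnorm p v.
Proof.
case: p => [r||]; last 2 first.
- move=> _; rewrite {1}/lpnorm; elim/big_ind: _ => [|x y x1 y1|j _].
  + by rewrite addr_ge0 ?lpnorm_ge0.
  + by rewrite ge_max x1.
  + by rewrite mxE (le_trans (ler_normD _ _))// lerD ?normr_le_lpnormy.
- by rewrite /= addr0.
rewrite lee_fin => r1; have r0 : 0 < r by rewrite (lt_le_trans _ r1).
have r00 := ltW r0.
have a0 := lpnorm_ge0 r%:E u; have b0 := lpnorm_ge0 r%:E v.
move: a0; rewrite le_eqVlt => /predU1P[/esym/(lpnorm_eq0 r0) u0|].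
  by rewrite u0 add0r lerDr lpnorm_ge0.
move: b0; rewrite le_eqVlt => /predU1P[/esym/(lpnorm_eq0 r0) v0|].
  by rewrite v0 addr0 lerDl lpnorm_ge0.
move Ea : (lpnorm r%:E u) => a; move Eb : (lpnorm r%:E v) => b b0 a0.
have ab0 : 0 < a + b by rewrite addr_gt0.
pose t := a / (a + b).
have t01 : 0 <= t <= 1.
  by rewrite /t divr_ge0 ?(ltW a0) ?(ltW ab0)//= ler_pdivrMr// mul1r lerDl ltW.
have tE : 1 - t = b / (a + b) by rewrite /t; field; rewrite gt_eqF.
have c0 j : 0 <= t * (`|u 0 j| / a) + (1 - t) * (`|v 0 j| / b).
  case/andP: t01 => t0 t1; rewrite addr_ge0// mulr_ge0//.
  - by rewrite divr_ge0// ltW.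
  - by rewrite subr_ge0.
  - by rewrite divr_ge0// ltW.
suff : \sum_(j < d) `|(u + v) 0 j| `^ r <= (a + b) `^ r.
  move=> h; rewrite /lpnorm; apply: le_trans (ge0_ler_powR _ _ _ h) _ => //.
  - by rewrite invr_ge0.
  - by rewrite nnegrE powR_sum_ge0.
  - by rewrite nnegrE powR_ge0.
  - by rewrite -powRrM mulfV ?gt_eqF// powRr1// ltW.
apply: (@le_trans _ _ (\sum_(j < d) (a + b) `^ r *
   (t * (`|u 0 j| / a) `^ r + (1 - t) * (`|v 0 j| / b) `^ r))).
  apply: ler_sum => j _.
  apply: le_trans (ler_wpM2l (powR_ge0 _ _)
    (convex_powRE r1 _ _ t01)); rewrite ?divr_ge0 ?(ltW a0) ?(ltW b0)//.
  rewrite -powRM ?(ltW ab0)// ge0_ler_powR ?nnegrE ?mulr_ge0 ?(ltW ab0)//.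
  rewrite mxE (le_trans (ler_normD _ _))// tE /t le_eqVlt; apply/orP; left.
  by apply/eqP; field; rewrite !gt_eqF.
rewrite -mulr_sumr ger_pMr ?powR_gt0// big_split/= -!mulr_sumr.
by rewrite !sum_powR_normalized// !mulr1 subrKC.
Qed.

Lemma lpnorm_convex p u v (t : R) : (1 <= p)%E -> 0 <= t <= 1 ->
  lpnorm p (t *: u + (1 - t) *: v) <= t * lpnorm p u + (1 - t) * lpnorm p v.
Proof.
move=> p1 /andP[t0 t1]; rewrite (le_trans (lpnormD _ _ _))//.
by rewrite !lpnormZ// subr_ge0.
Qed.

Lemma lpnorm1 v : lpnorm 1%E v = \sum_(j < d) `|v 0 j|.
Proof.
rewrite /= invr1 powRr1 ?powR_sum_ge0//.
by apply: eq_bigr => j _; rewrite powRr1.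
Qed.

Lemma dotp_lpnorm1y u v : dotp u v <= lpnorm 1%E u * lpnorm +oo%E v.
Proof.
rewrite lpnorm1 mulr_suml; apply: ler_sum => j _.
rewrite (le_trans (ler_norm _))// normrM ler_wpM2l// normr_le_lpnormy//.
Qed.

(** Young's inequality entry by entry on normalized vectors. The conjugacy relation lives in the
    extended reals, so the two pairs formed by [1] and [+oo] are covered and treated apart. *)
Lemma dotp_hoelder p b u v : (1 <= p)%E -> (p^-1 + b^-1 = 1)%E ->
  dotp u v <= lpnorm b u * lpnorm p v.
Proof.
case: p => [p||]//; last first.
  move=> _; rewrite invey add0e => b1.
  have -> : b = 1%E by rewrite -(inveK b) b1 inve1.
  exact: dotp_lpnorm1y.
rewrite lee_fin => p1; have p0 : 0 < p by rewrite (lt_le_trans _ p1).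
rewrite inver gt_eqF//; case: b => [b||]//; last first.
  rewrite invey adde0 => -[/eqP]; rewrite invr_eq1 => /eqP ->.
  by rewrite dotpC mulrC; exact: dotp_lpnorm1y.
rewrite inver; case: ifPn => // b0 [pb].
have bi0 : 0 <= b^-1.
  have p1' : p^-1 <= 1 by rewrite invf_le1.
  by lra.
have {bi0}b0 : 0 < b by rewrite lt_neqAle eq_sym b0/= -invr_ge0.
have x0 := lpnorm_ge0 b%:E u; have y0 := lpnorm_ge0 p%:E v.
move: x0; rewrite le_eqVlt => /predU1P[x0|].
  by rewrite (lpnorm_eq0 b0 (esym x0)) dotp0l mulr_ge0 ?lpnorm_ge0.
move: y0; rewrite le_eqVlt => /predU1P[y0|].
  by rewrite (lpnorm_eq0 p0 (esym y0)) dotp0r mulr_ge0 ?lpnorm_ge0.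
move Ex : (lpnorm b%:E u) => x; move Ey : (lpnorm p%:E v) => y y0 x0.
apply: (@le_trans _ _ (\sum_(j < d) (x * y) * ((`|v 0 j| / y) `^ p / p +
    (`|u 0 j| / x) `^ b / b))).
  apply: ler_sum => j _; rewrite (le_trans (ler_norm _))// normrM.
  apply: le_trans (ler_wpM2l (mulr_ge0 (ltW x0) (ltW y0))
    (conjugate_powR _ _ p0 b0 pb)); rewrite ?divr_ge0 ?(ltW x0) ?(ltW y0)//.
  by rewrite le_eqVlt; apply/orP; left; apply/eqP; field; rewrite !gt_eqF.
rewrite -mulr_sumr big_split/= -!mulr_suml !sum_powR_normalized//.
by rewrite !mul1r pb mulr1.
Qed.

(** The subgradient inequality at [u + e] and the triangle inequality give [dotp g e <= lpnorm p e],
    and signed basis vectors have norm one for every [p]. *)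
Lemma lpnorm_subgradient_le1 p u v g j : (1 <= p)%E ->
  is_subgradient (fun w => lpnorm p (w - v)) u g -> `|g 0 j| <= 1.
Proof.
move=> p1 h.
have k e : lpnorm p e <= 1 -> dotp g e <= 1.
  move=> e1; have /= := h (u + e).
  rewrite [X in dotp _ X]addrAC subrr add0r [X in _ <= lpnorm p X]addrAC => h1.
  by have := lpnormD (u - v) e p1; lra.
rewrite ler_norml lerNl -dotp_deltar -dotpNr.
by rewrite !k ?lpnormN ?lpnorm_delta.
Qed.

End LpNorm.

(** * Smooth strongly convex functions *)

Section Derivatives.
Context {R : realType}.

(** A limit along countably many steps, the form suited to measurability and dominated
    convergence. *)
Lemma is_derive_cvg_seq (phi : R -> R) (x l : R) : is_derive x (1 : R) phi l ->
  (n.+1%:R * (phi (x + n.+1%:R^-1) - phi x)) @[n --> \oo] --> l.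
Proof.
move=> -[dphi <-]; have /cvgr_dnbhsP/(_ (@harmonic R)) := dphi.
have h : (forall n, @harmonic R n != 0) /\ (@harmonic R n @[n --> \oo] --> 0).
  by split => [n|]; [rewrite gt_eqF// harmonic_gt0|exact: cvg_harmonic].
move=> /(_ h); apply: cvg_trans; apply: near_eq_cvg; apply: nearW => n.
by rewrite /= invrK /GRing.scale/= mulr1 (addrC x).
Qed.

(** Divide by [t] and let [t] tend to zero. The slack [e] carries the quadratic term of strong
    convexity; it is zero in optimality conditions. *)
Lemma is_derive_le_linear (phi : R -> R) (l c e : R) : is_derive (0 : R) (1 : R) phi l ->
  (forall t, 0 < t <= 1 -> phi t - phi 0 <= t * (c + t * e)) -> l <= c.
Proof.
move=> /is_derive_cvg_seq; under eq_fun do rewrite add0r.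
move=> phil h.
have ce : (c + @harmonic R n * e) @[n --> \oo] --> c.
  rewrite -[X in _ --> X]addr0; apply: cvgD; first exact: cvg_cst.
  rewrite -(mul0r e); apply: cvgM; [exact: cvg_harmonic|exact: cvg_cst].
apply: (ler_cvg_to phil ce); apply: nearW => n.
have n0 : 0 < n.+1%:R :> R by rewrite ltr0n.
rewrite -ler_pdivlMl//; apply: h.
by rewrite invr_gt0 n0 invf_le1// ler1n.
Qed.

End Derivatives.

Section Gradients.
Context {R : realType} {d : nat}.
Implicit Types (f : 'rV[R]_d -> R) (x y v : 'rV[R]_d).

Lemma derive_gradient f x v : differentiable f x ->
  'D_v f x = dotp (gradient f x) v.
Proof.
move=> df; rewrite deriveE// {1}(row_sum_delta v) linear_sum.
apply: eq_bigr => j _; rewrite linearZ/= mxE deriveE// mulrC.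
by [].
Qed.

Lemma is_derive_line f x v t : differentiable f (x + t *: v) ->
  is_derive t (1 : R) (fun t => f (x + t *: v)) (dotp (gradient f (x + t *: v)) v).
Proof.
move=> df; have E : (fun h : R => h^-1 *: (((fun t => f (x + t *: v)) \o shift t)
    (h *: 1) - f (x + t *: v))) =
    (fun h => h^-1 *: ((f \o shift (x + t *: v)) (h *: v) - f (x + t *: v))).
  apply/funext => h /=; congr (_ *: (f _ - _)).
  by rewrite scaler1 scalerDl addrCA.
split; first by rewrite /derivable E; exact: diff_derivable.
by rewrite /derive E -derive_gradient.
Qed.

Lemma is_derive_line0 f x v : differentiable f x ->
  is_derive (0 : R) (1 : R) (fun t : R => f (x + t *: v)) (dotp (gradient f x) v).
Proof.
move=> df; have := @is_derive_line f x v 0.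
by rewrite scale0r addr0; exact.
Qed.

Lemma strongly_convex_gradient mu f x y : differentiable f x ->
  strongly_convex mu f ->
  f x + dotp (gradient f x) (y - x) + mu / 2 * dotp (y - x) (y - x) <= f y.
Proof.
move=> df fmu; set v := y - x.
suff : dotp (gradient f x) v <= f y - f x - mu / 2 * dotp v v by lra.
apply: (is_derive_le_linear (e := mu / 2 * dotp v v) (is_derive_line0 v df)).
move=> t /andP[t0 t1]; have := fmu y x t.
rewrite (ltW t0) t1 => /(_ isT); rewrite enorm_sqr -/v scale0r addr0.
have -> : t *: y + (1 - t) *: x = x + t *: v.
  by rewrite /v scalerBl scalerBr scale1r addrCA.
by lra.
Qed.

(** The descent lemma. Subtracting the linear and quadratic terms along the segment leaves a
    function [phi] with [phi' <= 0] on []0, 1[], to which the mean value theorem applies. *)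
Lemma lipschitz_gradient_le L f x y : lipschitz_gradient L f -> 0 < L ->
  f y <= f x + dotp (gradient f x) (y - x) + L / 2 * dotp (y - x) (y - x).
Proof.
move=> [df fL] L0; set v := y - x; set g := gradient f x.
pose phi (t : R) := f (x + t *: v) - t * dotp g v - L / 2 * t ^+ 2 * dotp v v.
pose dphi (t : R) := dotp (gradient f (x + t *: v)) v - dotp g v - L * t * dotp v v.
have phi' t : is_derive t (1 : R) phi (dphi t).
  have h := is_derive_line (df (x + t *: v)).
  have h1 := is_deriveZ (dotp g v) (is_derive_id t (1 : R)).
  have h2 := is_deriveZ (L / 2 * dotp v v)
    (is_deriveM (is_derive_id t (1 : R)) (is_derive_id t (1 : R))).
  have -> : phi = (fun t => f (x + t *: v)) - (dotp g v \*: id) -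
      ((L / 2 * dotp v v) \*: (id * id)).
    apply/funext => u.
    transitivity (f (x + u *: v) - dotp g v * u - L / 2 * dotp v v * (u * u)) => //.
    by rewrite /phi; ring.
  apply: is_derive_eq.
  transitivity (dotp (gradient f (x + t *: v)) v - dotp g v * 1 -
      L / 2 * dotp v v * (t * 1 + t * 1)) => //.
  by rewrite /dphi; field.
have phic : {within `[0, 1], continuous phi}.
  by apply: derivable_within_continuous => t _; case: (phi' t).
have [c /[!in_itv]/= /andP[c0 c1]] := MVT ltr01 (fun t _ => phi' t) phic.
rewrite subr0 mulr1 /phi scale1r scale0r addr0 expr0n/= mulr0 !mul0r !subr0 expr1n.
rewrite subrKC -/v => E.
suff : dphi c <= 0 by rewrite -E; lra.
have := fL (x + c *: v) x; move/dotp_le_enorm.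
rewrite (_ : x + c *: v - x = c *: v) ?dotpZl ?dotpZr => [h|]; last first.
  by rewrite addrAC subrr add0r.
have Lc : 0 < L * c by rewrite mulr_gt0.
(* This weight balances both sides, since gradients at distance [c |v|] differ by at most
   [L c |v|]. *)
have := dotp_young (gradient f (x + c *: v) - g) v; move=> /(_ (L * c)^-1).
rewrite invr_gt0 => /(_ Lc); rewrite invrK.
have : (L * c)^-1 * dotp (gradient f (x + c *: v) - g) (gradient f (x + c *: v) - g)
    <= L * c * dotp v v.
  by rewrite ler_pdivrMl// (le_trans h)// le_eqVlt; apply/orP; left; apply/eqP; ring.
by rewrite /dphi !dotpE; lra.
Qed.

(** Along a unit vector, which exists because [d > 0], the gradient grows at least at rate [mu] and
    at most at rate [L]. *)
Lemma strongly_convex_le_lipschitz mu L f : (0 < d)%N -> 0 < mu ->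
  strongly_convex mu f -> lipschitz_gradient L f -> mu <= L.
Proof.
move=> d0 mu0 fmu fL; have [df Lf] := fL.
pose v : 'rV[R]_d := delta_mx 0 (Ordinal d0).
have vv : dotp v v = 1 by rewrite dotp_deltal mxE !eqxx.
have := Lf v 0; move: (enorm_ge0 (gradient f v - gradient f 0)) => h0 h.
have L0 : 0 <= L.
  have := le_trans h0 h.
  have -> : enorm (v - 0) = 1.
    apply/eqP; rewrite -(@eqrXn2 _ 2)// ?enorm_ge0//.
    by rewrite enorm_sqr subr0 vv expr1n.
  by rewrite mulr1.
have h1 := strongly_convex_gradient 0 (df v) fmu.
have h2 := strongly_convex_gradient v (df 0) fmu.
have {}h := dotp_le_enorm h.
move: h1 h2 h; rewrite subr0 sub0r !dotpE vv.
set a := dotp (gradient f v) v; set b := dotp (gradient f 0) v => h1 h2 h.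
have ab e : 0 < e -> 2 * (a - b) <= e * L ^+ 2 + e^-1.
  move=> e0; have := dotp_young (gradient f v - gradient f 0) v e0.
  rewrite vv mulr1 !dotpE -/a -/b => /le_trans; apply.
  by rewrite lerD2r ler_pM2l// (le_trans _ (le_trans h _))// ?mulr1// !dotpE.
(* If [L = 0], the weight [1 / mu] contradicts [mu <= a - b]; otherwise the weight [1 / L] yields
   [a - b <= L]. *)
move: L0; rewrite le_eqVlt => /predU1P[L0|L0].
  have := ab mu^-1; rewrite invr_gt0 invrK -L0 expr0n/= mulr0 => /(_ mu0); lra.
have := ab L^-1; rewrite invr_gt0 invrK expr2 mulKf ?gt_eqF// => /(_ L0); lra.
Qed.

(** Cocoercivity of the convex, [L - mu] smooth function [f - mu/2 |.|^2], rewritten for [f]. When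
    [mu = L] there is no step length [1 / (L - mu)], and strong monotonicity with the Lipschitz
    bound gives the claim directly. *)
Lemma gradient_cocoercive mu L f x y : (0 < d)%N -> 0 < mu ->
  strongly_convex mu f -> lipschitz_gradient L f ->
  mu * L * dotp (x - y) (x - y) +
    dotp (gradient f x - gradient f y) (gradient f x - gradient f y) <=
  (mu + L) * dotp (gradient f x - gradient f y) (x - y).
Proof.
move=> d0 mu0 fmu fL; have [df Lf] := fL.
have muL := strongly_convex_le_lipschitz d0 mu0 fmu fL.
have L0 : 0 < L := lt_le_trans mu0 muL.
have low u w := strongly_convex_gradient w (df u) fmu.
set a := gradient f x - gradient f y; set v := x - y.
have hv : mu * dotp v v <= dotp a v.
  have := low x y; have := low y x; rewrite -(opprB x y) -/v.
  by rewrite /a !dotpE; lra.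
move: muL; rewrite le_eqVlt => /predU1P[muL|muL].
  have := dotp_le_enorm (Lf x y); rewrite -/a -/v -muL => h.
  have : 2 * mu * (mu * dotp v v) <= 2 * mu * dotp a v.
    by rewrite ler_pM2l// mulr_gt0.
  by lra.
pose M := L - mu; have M0 : 0 < M by rewrite subr_gt0.
(* [f - mu/2 |.|^2] is convex and [M]-smooth: evaluate it at the point reached
   from [y] by a gradient step of length [1/M]. *)
have key u w e g : w - u = e -> gradient f w - gradient f u - mu *: e = g ->
    f u + dotp (gradient f u) e + mu / 2 * dotp e e + (2 * M)^-1 * dotp g g <= f w.
  move=> Ee Eg; have := low u (w - M^-1 *: g).
  have := lipschitz_gradient_le w (w - M^-1 *: g) fL L0.
  have -> : w - M^-1 *: g - w = - (M^-1 *: g) by rewrite addrAC subrr add0r.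
  have -> : w - M^-1 *: g - u = e - M^-1 *: g by rewrite -Ee addrAC.
  move: (gradient f w) (gradient f u) Eg => gw gu Eg.
  have {}Eg : dotp gw g = dotp gu g + dotp g g + mu * dotp e g.
    by have := congr1 (dotp^~ g) Eg; rewrite !dotpE; lra.
  rewrite !dotpE Eg (dotpC g e) => h1 h2.
  have E : (2 * M)^-1 * dotp g g = M^-1 * dotp g g - M / 2 * (M^-1 * (M^-1 * dotp g g)).
    by field; rewrite gt_eqF.
  rewrite E; have {}E : M / 2 * (M^-1 * (M^-1 * dotp g g)) =
    L / 2 * (M^-1 * (M^-1 * dotp g g)) - mu / 2 * (M^-1 * (M^-1 * dotp g g)).
    by rewrite -mulrBl -mulrBl.
  by lra.
have e1 : y - x = - v by rewrite opprB.
have e2 : gradient f y - gradient f x - mu *: - v = - (a - mu *: v).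
  by rewrite scalerN opprK opprB [RHS]addrC opprB addrC.
(* Adding the inequality for both orders of the two points cancels the function values. *)
have {key} := lerD (key y x v (a - mu *: v) erefl erefl) (key x y _ _ e1 e2).
move: @a hv {e1 e2}; move: (gradient f x) (gradient f y) v => gx gy v a hv.
rewrite !(dotpNl, dotpNr) !opprK => h.
have {}h : M^-1 * dotp (a - mu *: v) (a - mu *: v) <= dotp a v - mu * dotp v v.
  have -> : M^-1 = (2 * M)^-1 + (2 * M)^-1 by field; rewrite gt_eqF.
  by rewrite /a !dotpDl !dotpNl in h *; lra.
rewrite ler_pdivrMl// in h; move: h; rewrite /M.
clearbody a; rewrite !dotpE (dotpC v a); lra.
Qed.

End Gradients.

(** * Deterministic descent step and the penalized problem *)

Section GradientStep.
Context {R : realType} {d : nat}.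
Implicit Types (A a g n u v : 'rV[R]_d).

(** Cocoercivity turns [2 alpha <a, A>] into the contraction plus [2 alpha / (mu + L) |a|^2]; the
    cap [alpha <= 1 / (2 (mu + L))] makes the latter absorb the [4 alpha^2 |a|^2] of the expanded
    square. The factors 4 and 2 come from splitting [(a + g) + n], then [a + g]. *)
Lemma gradient_step_le (mu L alpha eta : R) A a g n :
  0 < mu + L -> 0 <= alpha -> alpha * (2 * (mu + L)) <= 1 ->
  eta <= 2 * mu * L / (mu + L) ->
  mu * L * dotp A A + dotp a a <= (mu + L) * dotp a A ->
  dotp (A - alpha *: (a + g + n)) (A - alpha *: (a + g + n)) <=
    (1 - alpha * eta) * dotp A A - 2 * alpha * dotp g A - 2 * alpha * dotp n A
    + alpha ^+ 2 * (4 * dotp g g + 2 * dotp n n).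
Proof.
move=> c0 al0 al1 etal coc.
have h1 := dotp_sqrD (a + g) n; have h2 := dotp_sqrD a g.
have {h1 h2} h : dotp (a + g + n) (a + g + n) <=
    4 * dotp a a + 4 * dotp g g + 2 * dotp n n by lra.
have {}h := ler_wpM2l (sqr_ge0 alpha) h.
have h3 : alpha * eta * dotp A A <= alpha * (2 * mu * L / (mu + L)) * dotp A A.
  by rewrite ler_wpM2r ?dotp_ge0// ler_wpM2l.
have h4 : 2 * (alpha ^+ 2 * dotp a a) <= alpha / (mu + L) * dotp a a.
  rewrite mulrA ler_wpM2r ?dotp_ge0// ler_pdivlMr//.
  have := ler_wpM2l al0 al1; rewrite mulr1; apply: le_trans.
  by rewrite le_eqVlt; apply/orP; left; apply/eqP; ring.
have h5 : alpha / (mu + L) * (mu * L * dotp A A + dotp a a) <= alpha * dotp a A.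
  rewrite -mulrA ler_wpM2l// ler_pdivrMl//.
have E1 : dotp (A - alpha *: (a + g + n)) (A - alpha *: (a + g + n)) =
    dotp A A - 2 * alpha * dotp a A - 2 * alpha * dotp g A - 2 * alpha * dotp n A
    + alpha ^+ 2 * dotp (a + g + n) (a + g + n).
  by rewrite !dotpE (dotpC A a) (dotpC A g) (dotpC A n); ring.
have E2 : alpha * (2 * mu * L / (mu + L)) * dotp A A =
    2 * (alpha / (mu + L) * (mu * L * dotp A A)) by field; rewrite gt_eqF.
rewrite E1; rewrite E2 in h3; rewrite mulrDr in h5.
set X := dotp A A in h3 h5 *; set Y := dotp a a in h h4 h5.
move: h h3 h4 h5; rewrite !mulrDr.
set Z := alpha ^+ 2 * dotp _ _; set e := alpha / (mu + L) * Y.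
set w := alpha / (mu + L) * (mu * L * X); move: Z e w => Z e w h h3 h4 h5.
by lra.
Qed.

(** Only the total cross term of the [g] has a sign, so the components are summed before it is
    dropped. The master contracts at rate [eta + eps]; the share [eps] pays for the Byzantine term
    [T]. *)
Lemma stack_step_le (m : nat) (I : {set 'I_m}) (mu L : 'I_m -> R)
    (mu0 L0 alpha eta eps B B0 BT : R)
    (A a g n : 'I_m -> 'rV[R]_d) A0 a0 g0 T :
  0 <= alpha -> 0 < eps ->
  (forall i, i \in I -> [/\ 0 < mu i + L i, alpha * (2 * (mu i + L i)) <= 1,
    eta <= 2 * mu i * L i / (mu i + L i) &
    mu i * L i * dotp (A i) (A i) + dotp (a i) (a i) <=
      (mu i + L i) * dotp (a i) (A i)]) ->
  (forall i, i \in I -> dotp (g i) (g i) <= B) ->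
  [/\ 0 < mu0 + L0, alpha * (2 * (mu0 + L0)) <= 1,
    eta + eps <= 2 * mu0 * L0 / (mu0 + L0) &
    mu0 * L0 * dotp A0 A0 + dotp a0 a0 <= (mu0 + L0) * dotp a0 A0] ->
  dotp g0 g0 <= B0 -> dotp T T <= BT ->
  0 <= \sum_(i in I) dotp (g i) (A i) + dotp g0 A0 ->
  \sum_(i in I) dotp (A i - alpha *: (a i + g i + n i))
                     (A i - alpha *: (a i + g i + n i))
    + dotp (A0 - alpha *: (a0 + g0 + T)) (A0 - alpha *: (a0 + g0 + T)) <=
  (1 - alpha * eta) * (\sum_(i in I) dotp (A i) (A i) + dotp A0 A0)
  + alpha ^+ 2 * (4 * #|I|%:R * B + 4 * B0 + 2 * BT) + alpha * (BT / eps)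
  + \sum_(i in I) (2 * alpha ^+ 2 * dotp (n i) (n i) - 2 * alpha * dotp (n i) (A i)).
Proof.
move=> al0 eps0 hI hB [h01 h02 h03 h04] hB0 hBT mono.
have hsum : \sum_(i in I) dotp (A i - alpha *: (a i + g i + n i))
    (A i - alpha *: (a i + g i + n i)) <=
    (1 - alpha * eta) * (\sum_(i in I) dotp (A i) (A i))
    - 2 * alpha * (\sum_(i in I) dotp (g i) (A i))
    + alpha ^+ 2 * (4 * #|I|%:R * B)
    + \sum_(i in I) (2 * alpha ^+ 2 * dotp (n i) (n i) - 2 * alpha * dotp (n i) (A i)).
  have -> : alpha ^+ 2 * (4 * #|I|%:R * B) = \sum_(i in I) (alpha ^+ 2 * (4 * B)).
    by rewrite sumr_const -mulr_natr; ring.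
  rewrite !mulr_sumr -sumrB -!big_split/=.
  apply: ler_sum => i iI; have [h1 h2 h3 h4] := hI i iI.
  apply: (le_trans (gradient_step_le (g i) (n i) h1 al0 h2 h3 h4)).
  have := ler_wpM2l (sqr_ge0 alpha) (hB i iI).
  move: (dotp _ _) (dotp _ _) (dotp _ _) (dotp _ _) => *; lra.
(* Young with weight [1 / eps] spends [alpha eps |A0|^2] of the contraction. *)
have hT : - (2 * alpha * dotp T A0) <= alpha * eps * dotp A0 A0 + alpha * (BT / eps).
  have := dotp_young (- T) A0; move=> /(_ eps^-1).
  rewrite invr_gt0 invrK => /(_ eps0); rewrite !dotpE opprK => h.
  have h' : eps^-1 * dotp T T <= BT / eps by rewrite mulrC ler_pM2r ?invr_gt0.
  have : 2 * - dotp T A0 <= BT / eps + eps * dotp A0 A0 by lra.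
  by move=> /(ler_wpM2l al0); lra.
have h0 := gradient_step_le g0 T h01 al0 h02 h03 h04.
apply: (le_trans (lerD hsum h0)).
have g1 := ler_wpM2l (sqr_ge0 alpha) hB0.
have g2 := ler_wpM2l (sqr_ge0 alpha) hBT.
have g3 := mulr_ge0 al0 mono.
set X := \sum_(i in I) (2 * _ * _ - _).
move: g3 g2 g1 hT; rewrite !mulrDr !mulrDl.
move: (dotp _ _) (dotp g0 A0) (dotp T T) (dotp g0 g0) (\sum_(i in I) _) => *.
lra.
Qed.

End GradientStep.

(** * The penalized problem: optimality conditions and exactness of the penalty *)

Section Consensus.
Context {R : realType} {d m : nat}.
Variables (I : {set 'I_m}) (p : \bar R) (lambda : R).
Variables (f : 'I_m -> 'rV[R]_d -> R) (f0 : 'rV[R]_d -> R).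
Hypotheses (p1 : (1 <= p)%E) (lambda0 : 0 < lambda).
Hypotheses (df : forall i u, differentiable (f i) u)
  (df0 : forall u, differentiable f0 u).

Lemma is_derive_finset_sum (A : {set 'I_m}) (h : 'I_m -> R -> R) (dh : 'I_m -> R)
    (x : R) : (forall i, is_derive x (1 : R) (h i) (dh i)) ->
  is_derive x (1 : R) (fun t => \sum_(i in A) h i t) (\sum_(i in A) dh i).
Proof.
move=> hd.
have -> : (fun t => \sum_(i in A) h i t) = \sum_(i in A) h i.
  by apply/funext => t; rewrite fct_sumE.
elim/big_rec2: _ => [|i D F _ HF]; first exact: is_derive_cst.
exact: is_deriveD.
Qed.

Lemma is_derive_stack (x y : 'I_m -> 'rV[R]_d) x0 y0 :
  is_derive (0 : R) (1 : R)
    (fun t => \sum_(i in I) f i (x i + t *: y i) + f0 (x0 + t *: y0))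
    (\sum_(i in I) dotp (gradient (f i) (x i)) (y i) + dotp (gradient f0 x0) y0).
Proof.
apply: is_deriveD; last exact: is_derive_line0.
by apply: is_derive_finset_sum => i; exact: is_derive_line0.
Qed.

(** On the segment to [(y, y0)], convexity bounds the increment of the penalty by [t] times its
    total increment. Minimality makes this bound the decrease of the smooth part, whose derivative
    at [t = 0] gives the claim. *)
Lemma consensus_minimizer_subgradient (x : 'I_m -> 'rV[R]_d) x0 :
  (forall (y : 'I_m -> 'rV[R]_d) (y0 : 'rV[R]_d),
     \sum_(i in I) (f i (x i) + lambda * lpnorm p (x i - x0)) + f0 x0
     <= \sum_(i in I) (f i (y i) + lambda * lpnorm p (y i - y0)) + f0 y0) ->
  forall (y : 'I_m -> 'rV[R]_d) (y0 : 'rV[R]_d),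
  lambda * consensus_penalty I p x x0 <=
    lambda * consensus_penalty I p y y0 +
    (\sum_(i in I) dotp (gradient (f i) (x i)) (y i - x i)
     + dotp (gradient f0 x0) (y0 - x0)).
Proof.
move=> xmin y y0.
have /is_deriveN dS := is_derive_stack x (fun i => y i - x i) x0 (y0 - x0).
suff : - (\sum_(i in I) dotp (gradient (f i) (x i)) (y i - x i)
     + dotp (gradient f0 x0) (y0 - x0)) <=
   lambda * (consensus_penalty I p y y0 - consensus_penalty I p x x0) by lra.
apply: (is_derive_le_linear (e := 0) dS) => t /andP[t0 t1]; rewrite mulr0 addr0.
rewrite !fctE.
have := xmin (fun i => x i + t *: (y i - x i)) (x0 + t *: (y0 - x0)).
rewrite scale0r addr0; under [X in _ - - (X + _)]eq_bigr do rewrite scale0r addr0.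
rewrite !big_split/= -!mulr_sumr.
suff : \sum_(i in I) lpnorm p (x i + t *: (y i - x i) - (x0 + t *: (y0 - x0))) <=
   t * consensus_penalty I p y y0 + (1 - t) * consensus_penalty I p x x0.
  by move=> /(ler_wpM2l (ltW lambda0)); rewrite /consensus_penalty; lra.
rewrite !mulr_sumr -big_split/=; apply: ler_sum => i _.
have -> : x i + t *: (y i - x i) - (x0 + t *: (y0 - x0)) =
  t *: (y i - y0) + (1 - t) *: (x i - x0).
  by apply/rowP => j; rewrite !mxE; ring.
by apply: lpnorm_convex; rewrite // (ltW t0).
Qed.

(** Moving the master component affects all [#|I|] terms, moving one worker a single term; hence the
    factor [r] in the gradient bound of the master only. *)
Lemma consensus_penalty_shift0 (x : 'I_m -> 'rV[R]_d) x0 u :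
  consensus_penalty I p x (x0 + u) <=
    consensus_penalty I p x x0 + #|I|%:R * lpnorm p u.
Proof.
have -> : #|I|%:R * lpnorm p u = \sum_(i in I) lpnorm p u.
  by rewrite sumr_const mulr_natl.
rewrite -big_split/=; apply: ler_sum => i _.
by rewrite opprD addrA (le_trans (lpnormD _ _ p1))// lpnormN.
Qed.

Lemma consensus_penalty_shift (x : 'I_m -> 'rV[R]_d) x0 u k : k \in I ->
  consensus_penalty I p (fun i => if i == k then x i + u else x i) x0 <=
    consensus_penalty I p x x0 + lpnorm p u.
Proof.
move=> kI; rewrite /consensus_penalty !(bigD1 k kI)/= eqxx.
rewrite [in leLHS](eq_bigr (fun i => lpnorm p (x i - x0))); last first.
  by move=> i /andP[_ /negPf ->].
by rewrite [leRHS]addrAC lerD2r (addrAC (x k)) lpnormD.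
Qed.

Section Minimizer.
Variables (x : 'I_m -> 'rV[R]_d) (x0 : 'rV[R]_d).
Hypothesis xmin : forall (y : 'I_m -> 'rV[R]_d) (y0 : 'rV[R]_d),
  \sum_(i in I) (f i (x i) + lambda * lpnorm p (x i - x0)) + f0 x0
  <= \sum_(i in I) (f i (y i) + lambda * lpnorm p (y i - y0)) + f0 y0.

(** Test the optimality condition by moving component [i] alone along a signed basis vector, which
    raises the penalty by at most one. *)
Lemma consensus_gradient_le i j : i \in I ->
  `|gradient (f i) (x i) 0 j| <= lambda.
Proof.
move=> iI.
have k u : lpnorm p u = 1 -> - dotp (gradient (f i) (x i)) u <= lambda.
  move=> u1; have := consensus_minimizer_subgradient xmin
    (fun k => if k == i then x k + u else x k) x0.
  have := ler_wpM2l (ltW lambda0) (consensus_penalty_shift x x0 u iI).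
  rewrite subrr dotp0r addr0 (bigD1 i iI)/= eqxx big1 ?addr0; last first.
    by move=> l /andP[_ /negPf ->]; rewrite subrr dotp0r.
  by rewrite addrAC subrr add0r u1; lra.
rewrite ler_norml lerNl -dotp_deltar k ?lpnorm_delta//=.
by rewrite -(opprK (dotp _ _)) -dotpNr k// lpnormN lpnorm_delta.
Qed.

Lemma consensus_gradient0_le j : `|gradient f0 x0 0 j| <= lambda * #|I|%:R.
Proof.
have k u : lpnorm p u = 1 -> - dotp (gradient f0 x0) u <= lambda * #|I|%:R.
  move=> u1; have := consensus_minimizer_subgradient xmin x (x0 + u).
  have := ler_wpM2l (ltW lambda0) (consensus_penalty_shift0 x x0 u).
  rewrite big1 => [|i _]; last by rewrite subrr dotp0r.
  by rewrite addrAC subrr !add0r u1 mulr1 mulrDr; lra.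
rewrite ler_norml lerNl -dotp_deltar k ?lpnorm_delta//=.
by rewrite -(opprK (dotp _ _)) -dotpNr k// lpnormN lpnorm_delta.
Qed.

(** Monotonicity of the subdifferential of the penalty between the current stack and the minimizer:
    add the two subgradient inequalities. Both compare whole stacks, hence the joint subgradient. *)
Lemma consensus_monotone (y s w : 'I_m -> 'rV[R]_d) y0 :
  is_stack_subgradient I p y y0 s w ->
  0 <= \sum_(i in I) dotp (lambda *: s i + gradient (f i) (x i)) (y i - x i)
    + dotp (lambda *: (\sum_(i in I) w i) + gradient f0 x0) (y0 - x0).
Proof.
move=> /(_ x x0)/(ler_wpM2l (ltW lambda0)) h1.
have h2 := consensus_minimizer_subgradient xmin y y0.
rewrite dotpDl dotpZl.
under eq_bigr do rewrite dotpDl dotpZl.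
rewrite big_split/= -mulr_sumr.
have E : \sum_(i in I) dotp (s i) (x i - y i) = - \sum_(i in I) dotp (s i) (y i - x i).
  by rewrite -sumrN; apply: eq_bigr => i _; rewrite -dotpNr opprB.
by move: h1; rewrite E -(opprB y0 x0) dotpNr; lra.
Qed.

End Minimizer.

(** Exactness of the penalty: once [lambda] dominates the dual norms of the local gradients at [xt],
    disagreement costs at least its first-order gain. Copies of [xt] then beat every stack by the
    strong convexity squares, which must vanish at a minimizer. *)
Lemma consensus_minimizer_unique (b : \bar R) (mu : 'I_m -> R) (mu0 : R)
    (xt : 'rV[R]_d) (x : 'I_m -> 'rV[R]_d) x0 :
  (p^-1 + b^-1 = 1)%E ->
  (forall i, 0 < mu i) -> 0 < mu0 ->
  (forall i, strongly_convex (mu i) (f i)) -> strongly_convex mu0 f0 ->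
  (forall y, \sum_(i in I) f i xt + f0 xt <= \sum_(i in I) f i y + f0 y) ->
  (forall i, i \in I -> lpnorm b (gradient (f i) xt) <= lambda) ->
  (forall (y : 'I_m -> 'rV[R]_d) (y0 : 'rV[R]_d),
     \sum_(i in I) (f i (x i) + lambda * lpnorm p (x i - x0)) + f0 x0
     <= \sum_(i in I) (f i (y i) + lambda * lpnorm p (y i - y0)) + f0 y0) ->
  (forall i, i \in I -> x i = xt) /\ x0 = xt.
Proof.
move=> pb mupos mu0pos cf cf0 xtmin hb xmin.
have grad0 v : 0 <= dotp (\sum_(i in I) gradient (f i) xt + gradient f0 xt) v.
  have /is_deriveN dS := is_derive_stack (fun=> xt) (fun=> v) xt v.
  rewrite dotpDl dotp_suml -oppr_le0.
  apply: (is_derive_le_linear (e := 0) dS) => t _; rewrite !mulr0 addr0 mulr0.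
  rewrite !fctE.
  rewrite scale0r addr0.
  by have := xtmin (xt + t *: v); lra.
(* Apply the inequality to both [v] and [- v]. *)
have {}grad0 v : dotp (\sum_(i in I) gradient (f i) xt + gradient f0 xt) v = 0.
  by apply/eqP; rewrite eq_le grad0 andbT -oppr_ge0 -dotpNr grad0.
have h0 := strongly_convex_gradient x0 (df0 xt) cf0.
have hi : \sum_(i in I) (f i xt + mu i / 2 * dotp (x i - xt) (x i - xt)) <=
   \sum_(i in I) (f i (x i) + lambda * lpnorm p (x i - x0)
     - dotp (gradient (f i) xt) (x0 - xt)).
  apply: ler_sum => i iI.
  have := strongly_convex_gradient (x i) (df i xt) (cf i).
  (* Replacing [x i] by [x0] in the linear term costs at most the penalty. *)
  have := dotp_hoelder (gradient (f i) xt) (- (x i - x0)) p1 pb.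
  rewrite lpnormN => /le_trans /(_ (ler_wpM2r (lpnorm_ge0 _ _) (hb i iI))).
  rewrite !dotpDr !dotpNr !dotpDr !dotpNr; lra.
have := grad0 (x0 - xt); rewrite dotpDl dotp_suml => E.
have := xmin (fun=> xt) xt.
rewrite [X in _ <= X + _](eq_bigr (fun i => f i xt)); last first.
  by move=> i _; rewrite subrr lpnorm0// mulr0 addr0.
move: hi; rewrite sumrB [X in X <= _]big_split/= => hi hmin.
have q0 := dotp_ge0 (x0 - xt).
have q0' : 0 <= mu0 / 2 * dotp (x0 - xt) (x0 - xt).
  by rewrite mulr_ge0// divr_ge0// ltW.
have qi i : 0 <= mu i / 2 * dotp (x i - xt) (x i - xt).
  by rewrite mulr_ge0 ?dotp_ge0// divr_ge0// ltW.
have qs : 0 <= \sum_(i in I) mu i / 2 * dotp (x i - xt) (x i - xt).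
  by apply: sumr_ge0 => i _.
have conc (u v : 'rV[R]_d) c : 0 < c -> c / 2 * dotp (u - v) (u - v) = 0 -> u = v.
  move=> c0 /eqP; rewrite mulf_eq0 gt_eqF ?divr_gt0//= => /eqP/dotp_eq0/eqP.
  by rewrite subr_eq0 => /eqP.
split; last by apply: (conc _ _ mu0) => //; lra.
move=> i iI; apply: (conc _ _ (mu i)) => //.
have : \sum_(i in I) mu i / 2 * dotp (x i - xt) (x i - xt) = 0 by lra.
move=> /eqP; rewrite psumr_eq0// => /allP/(_ i).
by rewrite mem_index_enum iI/= => /(_ isT)/eqP.
Qed.

End Consensus.

(** * Exchanging derivative and expectation *)

Section MeanValueInequality.
Context {R : realType}.
Local Notation mu := (@lebesgue_measure R).

(* [G x] stands for the integral over [a, x] of the lower semicontinuous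
   function [\sum_n c_n 1_(U_n)], so that no differentiation theorem is needed. *)
Lemma increment_le_open_cover (phi dphi : R -> R) (a b : R)
    (U : nat -> set R) (c : nat -> R) :
  a <= b -> (forall x, is_derive x (1 : R) phi (dphi x)) ->
  (forall n, open (U n)) -> (forall n, 0 <= c n) ->
  (forall x, a <= x <= b -> exists2 n, U n x & dphi x < c n) ->
  ((phi b - phi a)%:E <= \sum_(n <oo) (c n)%:E * mu (U n `&` `[a, b]))%E.
Proof.
move=> ab dP oU c0 cov.
have mU n : measurable (U n) by exact: open_measurable.
have mUi n (i : interval R) : measurable (U n `&` [set` i]).
  by apply: measurableI; [exact: mU|exact: measurable_itv].
pose G x : \bar R := (\sum_(n <oo) (c n)%:E * mu (U n `&` `[a, x]%classic))%E.
have Gpos n x : (0 <= (c n)%:E * mu (U n `&` `[a, x]%classic))%E.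
  by rewrite mule_ge0 ?lee_fin.
have Gmono x y : x <= y -> (G x <= G y)%E.
  move=> xy; apply: lee_nneseries => // n _; rewrite lee_wpmul2l ?lee_fin//.
  apply: le_measure; rewrite ?inE; try by exact: mUi.
  apply: setIS => z /=; rewrite !in_itv/= => /andP[-> zx].
  exact: le_trans xy.
(* While []x, y]] stays inside [U n], the function [G] grows at least with slope [c n]. *)
have Gstep n x y : a <= x -> x < y -> `]x, y] `<=` U n ->
    (G x + (c n * (y - x))%:E <= G y)%E.
  move=> ax xy sub.
  have -> : G y = (G x + \sum_(k <oo) (c k)%:E * mu (U k `&` `]x, y]%classic))%E.
    rewrite /G -nneseriesD//; last by move=> i _ _; rewrite mule_ge0 ?lee_fin.
    apply: eq_eseriesr => i _; rewrite -ge0_muleDr// -measureU//.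
    - congr (_ * mu _)%E; rewrite -setIUr; congr (_ `&` _).
      apply/seteqP; split => z /=; rewrite !in_itv/=.
        move=> /andP[az zy]; have [zx|xz] := leP z x; first by left; rewrite az.
        by right.
      move=> [/andP[-> zx]|/andP[xz ->]]; first by rewrite (le_trans zx)// ltW.
      by rewrite andbT (le_trans ax)// ltW.
    - exact: mUi.
    - exact: mUi.
    - rewrite setIACA setIid (_ : `[a, x] `&` `]x, y] = set0) ?setI0//.
      apply/seteqP; split => z //=; rewrite !in_itv/= => -[/andP[_ zx] /andP[xz _]].
      by move: (lt_le_trans xz zx); rewrite ltxx.
  apply: leeD2l.
  apply: le_trans (nneseries_lim_ge n.+1 _); last first.
    by move=> k _ _; rewrite mule_ge0 ?lee_fin.
  have -> : (c n * (y - x))%:E = ((c n)%:E * mu (U n `&` `]x, y]))%E.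
    have -> : U n `&` `]x, y] = `]x, y]%classic by apply/setIidPr.
    by rewrite lebesgue_measure_itv/= lte_fin xy -EFinB -EFinM.
  rewrite big_nat_recr//=; apply: leeDr.
  by apply: sume_ge0 => k _; rewrite mule_ge0 ?lee_fin.
(* Continuous induction: the inequality reaches the supremum of [S], and passes it unless the
   supremum is [b]. *)
pose S := [set x | a <= x <= b /\ ((phi x - phi a)%:E <= G x)%E].
have Sa : S a.
  by split; [rewrite lexx|rewrite subrr nneseries_ge0].
have supS : has_sup S.
  by split; [exists a|exists b => x [/andP[]]].
set s := sup S.
have sa : a <= s by apply: sup_upper_bound.
have sb : s <= b by apply: sup_le_ub => [|x [/andP[]]//]; exists a.
have phic : phi x @[x --> s] --> phi s.
  apply/differentiable_continuous/derivable1_diffP.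
  by case: (dP s).
(* If the bound failed at [s], continuity of [phi] would make it fail at nearby points of [S], where
   [G] is no larger than [G s]. *)
have Ss : S s.
  split; first by rewrite sa.
  rewrite leNgt; apply/negP => Gs.
  have Gfin : G s \is a fin_num.
    by rewrite ge0_fin_numE ?(lt_trans Gs) ?ltry// nneseries_ge0.
  move: Gs; rewrite -(fineK Gfin) lte_fin => Gs.
  have : \forall x \near s, fine (G s) + phi a < phi x.
    by apply: (cvgr_gt _ phic); rewrite -ltrBrDr.
  move=> /nbhs_ballP[e /= e0 he].
  have [x [/andP[ax xb] xG] sx] := sup_adherent e0 supS.
  have xs : x <= s by apply: sup_upper_bound => //; split => //; rewrite ax.
  have := he x; rewrite /ball/= ger0_norm ?subr_ge0// ltrBlDr -ltrBlDl => /(_ sx).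
  rewrite ltNge => /negP; apply; rewrite -lerBlDr.
  by rewrite -lee_fin fineK// (le_trans xG)// Gmono.
have [sbE|sltb] := eqVneq s b; first by case: Ss => _; rewrite sbE.
have {sltb}sltb : s < b by rewrite lt_neqAle sltb.
have [n Uns dsn] := cov s (introT andP (conj sa sb)).
have [e /= e0 eU] : \forall x \near s, U n x by apply: open_nbhs_nbhs; split.
have [e' /= e'0 he'] : \forall h \near 0^', h^-1 * (phi (h + s) - phi s) < c n.
  have [dps dpE] := dP s; move: dsn; rewrite -dpE => dsn.
  move: dps => /cvgr_lt/(_ _ dsn); apply: filterS => h.
  by rewrite /= /GRing.scale/= mulr1.
(* Small enough to stay in [U n], to keep the difference quotient below [c n], and not to pass
   [b]. *)
pose h := Num.min (Num.min (e / 2) (e' / 2)) (b - s).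
have h0 : 0 < h by rewrite !lt_min !divr_gt0//= subr_gt0.
have he : h < e.
  by rewrite (@le_lt_trans _ _ (e / 2)) ?ltr_pdivrMr ?ltr_pMr ?ltr1n// !ge_min lexx.
have hee : h < e'.
  by rewrite (@le_lt_trans _ _ (e' / 2)) ?ltr_pdivrMr ?ltr_pMr ?ltr1n// !ge_min lexx !orbT.
have hb : h + s <= b by rewrite -lerBrDr !ge_min lexx !orbT.
have sh : s < h + s by rewrite ltrDr.
suff : S (h + s) by move=> /(sup_upper_bound supS); rewrite -/s leNgt sh.
split; first by rewrite hb andbT (le_trans sa)// ltW.
apply: le_trans (Gstep n _ _ sa sh _); last first.
  move=> z /=; rewrite in_itv/= => /andP[sz zh]; apply: eU => /=.
  rewrite distrC ger0_norm ?subr_ge0 ?(ltW sz)//.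
  by rewrite (le_lt_trans _ he)// lerBlDr.
rewrite addrK; case: Ss => _ Ss.
have -> : phi (h + s) - phi a = (phi s - phi a) + (phi (h + s) - phi s) by ring.
rewrite EFinD; apply: leeD => //; rewrite lee_fin.
have := he' h; rewrite /= sub0r normrN gtr0_norm// => /(_ hee).
rewrite gt_eqF// => /(_ isT); rewrite ltr_pdivrMl// => /ltW.
by rewrite mulrC.
Qed.

(** Slice [[a, b]] into level sets of [|dphi|] of height [e] and cover each by an open set of
    slightly larger measure; the upper levels [(n + 1) e] serve as the slopes of the open cover. *)
Lemma increment_le_integral (phi dphi : R -> R) (a b : R) : a <= b ->
  (forall x, is_derive x (1 : R) phi (dphi x)) -> measurable_fun setT dphi ->
  ((phi b - phi a)%:E <= \int[mu]_(x in `[a, b]) `|dphi x|%:E)%E.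
Proof.
move=> ab dP mdphi.
have mabs : measurable_fun setT (fun x => `|dphi x|).
  by apply: measurableT_comp => //; exact: measurable_normr.
have muab : mu `[a, b] = (b - a)%:E.
  rewrite lebesgue_measure_itv/= lte_fin; case: ltgtP ab => // -> _.
  by rewrite subrr.
(* [e (b - a)] pays for the height of the slices, one more [e] for the total excess of the
   covers. *)
suff key e : 0 < e -> ((phi b - phi a)%:E <=
    \int[mu]_(x in `[a, b]) `|dphi x|%:E + (e * (b - a + 1))%:E)%E.
  apply/lee_addgt0Pr => e e0.
  have h : 0 < b - a + 1 by rewrite ltr_wpDl// subr_ge0.
  have := key (e / (b - a + 1)); rewrite divfK ?gt_eqF//; apply.
  by rewrite divr_gt0.
move=> e0; have e00 := ltW e0.
have mabse D : measurable_fun D (fun x => (`|dphi x| + e)%:E).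
  apply: (@measurable_funTS _ _ _ _ D); apply/measurable_EFinP.
  by apply: (measurable_funD mabs); exact: measurable_cst.
pose E n := [set x | a <= x <= b /\ n%:R * e <= `|dphi x| < n.+1%:R * e].
have EE n : E n = `[a, b] `&` ((fun x => `|dphi x|) @^-1` `[n%:R * e, n.+1%:R * e[).
  by apply/seteqP; split => x /=; rewrite /E/= !in_itv.
have mE n : measurable (E n).
  by rewrite EE; apply: measurableI => //; rewrite -[X in measurable X]setTI; exact: mabs.
have Eab n : E n `<=` `[a, b] by rewrite EE; exact: subIsetl.
have EbigU : \bigcup_n E n = `[a, b]%classic.
  apply/seteqP; split => [x [n _ /Eab]//|x]; rewrite /= in_itv/= => xab.
  exists (Num.truncn (`|dphi x| / e)) => //; split => //.
  have /andP[] := @truncn_itv R (`|dphi x| / e) (divr_ge0 (normr_ge0 _) e00).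
  by rewrite ler_pdivlMr// ltr_pdivrMr// => -> ->.
have Etriv : trivIset setT E.
  apply/trivIsetP => i j _ _ ij; apply/seteqP; split => // x [[_ /andP[i1 i2]] [_ /andP[j1 j2]]].
  have l k l : k%:R * e <= `|dphi x| -> `|dphi x| < l.+1%:R * e -> (k <= l)%N.
    by move=> h1 h2; have := le_lt_trans h1 h2; rewrite ltr_pM2r// ltr_nat.
  by move: ij; rewrite eqn_leq (l i j)// (l j i).
(* Multiplied by the slope [(n + 1) e], this excess measure costs [e / 2^(n+1)]. *)
pose e2 n := e / (2 ^ n.+1)%:R / (n.+1%:R * e).
have ne0 n : 0 < n.+1%:R * e by rewrite mulr_gt0.
have e20 n : 0 < e2 n by rewrite !divr_gt0// ltr0n expn_gt0.
have muE n : (mu (E n) < +oo)%E.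
  apply: (@le_lt_trans _ _ (mu `[a, b])); last by rewrite muab ltry.
  by apply: le_measure; rewrite ?inE; [exact: mE|exact: measurable_itv|exact: Eab].
have /choice[U hU] n := lebesgue_regularity_outer (mE n) (muE n) (e20 n).
have oU n : open (U n) by have [] := hU n.
have mU n : measurable (U n) by exact: open_measurable.
have mUE n : measurable (U n `\` E n).
  by apply: measurableD; [exact: mU|exact: mE].
have := @increment_le_open_cover phi dphi a b U (fun n => n.+1%:R * e) ab dP oU.
move=> /(_ (fun n => ltW (ne0 n))).
have cov x : a <= x <= b -> exists2 n, U n x & dphi x < n.+1%:R * e.
  move=> xab; have : (\bigcup_n E n) x by rewrite EbigU /= in_itv.
  move=> [n _ Enx]; exists n; first by have [_ sub _] := hU n; exact: sub.
  by have [_ /andP[_]] := Enx; apply: le_lt_trans; exact: ler_norm.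
move=> /(_ cov)/le_trans; apply.
apply: (@le_trans _ _ (\sum_(n <oo) (\int[mu]_(x in E n) (`|dphi x| + e)%:E +
    (e / (2 ^ n.+1)%:R)%:E))%E).
  apply: lee_nneseries => [n _ _|n _].
    by rewrite mule_ge0 ?lee_fin// ltW.
  apply: (@le_trans _ _ ((n.+1%:R * e)%:E * (mu (E n) + (e2 n)%:E))%E).
    rewrite lee_wpmul2l ?lee_fin ?(ltW (ne0 n))//.
    have [_ sub lt] := hU n.
    apply: (@le_trans _ _ (mu (E n `|` (U n `\` E n)))).
      apply: le_measure; rewrite ?inE.
      - by apply: measurableI; [exact: mU|exact: measurable_itv].
      - by apply: measurableU; [exact: mE|exact: mUE].
      - by move=> z [Uz _]; have [Ez|Ez] := pselect (E n z); [left|right].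
    apply: le_trans; first by apply: measureU2; [exact: mE|exact: mUE].
    by apply: leeD => //; exact: ltW.
  rewrite ge0_muleDr ?lee_fin ?(ltW (e20 n))//; apply: leeD.
    rewrite -(integral_cst mu (mE n)); apply: (ge0_le_integral mu (mE n)).
    - by move=> x _; rewrite lee_fin ltW.
    - exact: measurable_cst.
    - exact: mabse.
    - move=> x [_ /andP[h _]]; rewrite lee_fin -natr1 mulrDl mul1r lerD2r//.
  rewrite -EFinM lee_fin /e2 mulrC divfK ?gt_eqF//.
apply: (le_trans (epsilon_trick _ _ _)) => //.
  by move=> n; apply: integral_ge0 => x _; rewrite lee_fin addr_ge0.
rewrite -ge0_integral_bigcup//; last 2 first.
- exact: mabse.
- by move=> x _; rewrite lee_fin addr_ge0.
rewrite EbigU; under eq_integral do rewrite EFinD.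
rewrite (ge0_integralD mu (measurable_itv _)); last 4 first.
- by move=> x _; rewrite lee_fin.
- exact/measurable_EFinP/measurable_funTS.
- by move=> x _; rewrite lee_fin.
- exact: measurable_cst.
rewrite -addeA; apply: leeD => //.
have -> : (\int[mu]_(x in `[a, b]) e%:E = e%:E * (b - a)%:E)%E.
  by rewrite -muab; exact: (integral_cst mu (measurable_itv _) e%:E).
by rewrite -EFinM -EFinD lee_fin [leRHS]mulrDr mulr1.
Qed.

Lemma normr_increment_le_integral (phi dphi : R -> R) (a b : R) : a <= b ->
  (forall x, is_derive x (1 : R) phi (dphi x)) -> measurable_fun setT dphi ->
  (`|phi b - phi a|%:E <= \int[mu]_(x in `[a, b]) `|dphi x|%:E)%E.
Proof.
move=> ab dP mdphi; have [h|h] := leP 0 (phi b - phi a).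
  by rewrite ger0_norm//; exact: increment_le_integral.
have dN x : is_derive x (1 : R) (- phi) (- dphi x) by exact: is_deriveN.
have mN : measurable_fun setT (fun x => - dphi x).
  exact: measurableT_comp mdphi.
have := increment_le_integral ab dN mN; rewrite ltr0_norm// opprB.
rewrite !fctE opprK addrC.
by under eq_integral do rewrite normrN.
Qed.

End MeanValueInequality.

(** * Joint measurability of losses and gradients *)

Section Caratheodory.
Context {R : realType} {d : nat} {dT dX : measure_display}.
Context {T : measurableType dT} {Xi : measurableType dX}.
Variables (F : 'rV[R]_d -> Xi -> R) (u : T -> 'rV[R]_d).
Hypothesis mF : forall v, measurable_fun setT (F v).
Hypothesis mu_ : forall j, measurable_fun setT (fun t => u t 0 j).

(* [u] is approximated by grid-valued functions, for which the claim is a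
   countable union of measurable rectangles. *)
Lemma measurable_caratheodory : (forall zeta, continuous (F^~ zeta)) ->
  measurable_fun setT (fun z : T * Xi => F (u z.1) z.2).
Proof.
move=> cF.
(* Index of the grid cell of mesh [1 / (n + 1)] containing [u t]; [v n] returns the lower corner of
   the cell. *)
pose k n t : {ffun 'I_d -> int} := [ffun j => Num.floor (n.+1%:R * u t 0 j)].
pose v n (g : {ffun 'I_d -> int}) : 'rV[R]_d := \row_j ((g j)%:~R / n.+1%:R).
apply: (@measurable_fun_cvg _ _ _ setT (fun n z => F (v n (k n z.1)) z.2)).
  move=> n _ B mB; rewrite setTI.
  have -> : (fun z : T * Xi => F (v n (k n z.1)) z.2) @^-1` B =
      \bigcup_(g : {ffun 'I_d -> int})
        ([set t | k n t = g] `*` (F (v n g) @^-1` B)).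
    apply/seteqP; split => [[t zeta] /= h|[t zeta] [g _ [/= <-]]]//.
    by exists (k n t).
  apply: countable_bigcupT_measurable => [|g]; first exact: countableP.
  apply: measurableX; last first.
    by rewrite -[X in measurable X]setTI; exact: mF.
  have -> : [set t | k n t = g] = \bigcap_(j : 'I_d)
      [set t | n.+1%:R * u t 0 j \in `[(g j)%:~R, (g j + 1)%:~R[ ].
    apply/seteqP; split => [t <- j _ /=|t h].
      by rewrite ffunE in_itv/= floor_itv.
    apply/ffunP => j; rewrite ffunE; apply: floor_def.
    by have := h j I; rewrite /= in_itv.
  apply: fin_bigcap_measurable => [|j _]; first exact: finite_finset.
  rewrite -[X in measurable X]setTI.
  have mg : measurable_fun setT (fun t => n.+1%:R * u t 0 j).
    by apply: measurable_funM; [exact: measurable_cst|exact: mu_].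
  exact: (mg measurableT _ (measurable_itv `[(g j)%:~R, (g j + 1)%:~R[)).
move=> [t zeta] _ /=.
suff vu : v n (k n t) @[n --> \oo] --> u t.
  exact: (cvg_comp (fun n => v n (k n t)) (F^~ zeta) vu (cF zeta (u t))).
apply/cvg_ballP => e e0.
have := near_infty_natSinv_lt (PosNum e0); apply: filterS => n /= ne.
split => // i j; rewrite (ord1 i) mxE ffunE /ball/=.
have n0 : 0 < n.+1%:R :> R by rewrite ltr0n.
have /andP[h1 h2] := floor_itv (n.+1%:R * u t 0 j).
set m := Num.floor _ in h1 h2 *.
rewrite ger0_norm ?subr_ge0 ?ler_pdivrMr// 1?mulrC//.
rewrite (lt_trans _ ne)// ltrBlDr.
have -> : n.+1%:R^-1 + n.+1%:R^-1 * m%:~R = (1 + m%:~R) / n.+1%:R :> R.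
  by rewrite mulrDl mul1r mulrC.
rewrite ltr_pdivlMr// mulrC.
by rewrite (lt_le_trans h2)// intrD addrC.
Qed.

End Caratheodory.

(** A partial derivative is a pointwise limit of difference quotients, each jointly measurable
    because the loss is continuous in the point and measurable in the sample. *)
Lemma measurable_gradient {R : realType} {d : nat} {dT dX : measure_display}
    {T : measurableType dT} {Xi : measurableType dX}
    (F : 'rV[R]_d -> Xi -> R) (u : T -> 'rV[R]_d) j :
  (forall v, measurable_fun setT (F v)) ->
  (forall zeta v, differentiable (F^~ zeta) v) ->
  (forall j, measurable_fun setT (fun t => u t 0 j)) ->
  measurable_fun setT (fun z : T * Xi => gradient (F^~ z.2) (u z.1) 0 j).
Proof.
move=> mF dF mu_.
have cF zeta : continuous (F^~ zeta).
  by move=> v; exact: differentiable_continuous (dF zeta v).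
apply: (@measurable_fun_cvg _ _ _ setT (fun n z =>
    n.+1%:R * (F (u z.1 + (0 + n.+1%:R^-1) *: delta_mx 0 j) z.2
               - F (u z.1 + 0 *: delta_mx 0 j) z.2))).
  move=> n; have mdelta c : measurable_fun setT
      (fun z : T * Xi => F (u z.1 + c *: delta_mx 0 j) z.2).
    apply: (measurable_caratheodory (u := fun t => u t + c *: delta_mx 0 j)) => // i.
    under eq_fun do rewrite mxE.
    by apply: measurable_funD; [exact: mu_|exact: measurable_cst].
  apply: measurable_funM; first exact: measurable_cst.
  by apply: measurable_funB; exact: mdelta.
move=> [t zeta] _ /=.
have := is_derive_cvg_seq (is_derive_line0 (delta_mx 0 j) (dF zeta (u t))).
by rewrite dotp_deltar.
Qed.

Section Truncation.
Context {R : realType}.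

Definition truncate (K y : R) : R := Num.min K (Num.max (- K) y).

Lemma truncate_le (K y : R) : 0 <= K -> `|truncate K y| <= K.
Proof.
move=> K0; rewrite /truncate ler_norml ge_min lexx/= andbT le_min le_max lexx/= andbT.
by lra.
Qed.

Lemma truncate_error (K y w : R) : 0 <= K -> 0 <= w -> `|y| <= K + w ->
  `|y - truncate K y| <= w.
Proof.
move=> K0 w0; rewrite ler_norml => /andP[y1 y2].
rewrite /truncate ler_norml.
by case: (leP (- K) y) => ?; [case: (leP K y) => ?|case: (leP K (- K)) => ?];
  apply/andP; split; lra.
Qed.

Lemma truncate_lipschitz (K x y : R) : `|truncate K x - truncate K y| <= `|x - y|.
Proof.
rewrite /truncate ler_norml.
have := ler_norm (x - y); have := ler_norm (y - x); rewrite (distrC y x).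
case: (leP (- K) x) => ?; [case: (leP K x) => ?|case: (leP K (- K)) => ?];
  (case: (leP (- K) y) => ?; [case: (leP K y) => ?|try (case: (leP K (- K)) => ?)]);
  by move=> ? ?; apply/andP; split; lra.
Qed.

Lemma continuous_truncate (K : R) : continuous (truncate K).
Proof.
move=> y; apply/cvgrPdist_lt => e e0; apply/nbhs_ballP; exists e => // x.
by apply: le_lt_trans; exact: truncate_lipschitz.
Qed.

(** Expand [(|y| - 2 K)^2 >= 0]. The excess over [K] is charged to the second moment, at a price
    vanishing as [K] grows. *)
Lemma normr_le_young (K y : R) : 0 < K -> `|y| <= K + (4 * K)^-1 * y ^+ 2.
Proof.
move=> K0; have K40 : 0 < 4 * K by lra.
rewrite -lerBlDl ler_pdivlMl// -[y ^+ 2]real_normK ?num_real//.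
by have := sqr_ge0 (`|y| - 2 * K); rewrite sqrrB; lra.
Qed.

End Truncation.

(** * Derivative of an expectation under a second-moment bound *)

Section UnbiasedDerivative.
Context {R : realType} {dX : measure_display} {Xi : measurableType dX}.
Variables (D : probability Xi R) (psi dpsi : R -> Xi -> R) (C v : R).
Local Notation mu := (@lebesgue_measure R).
Hypothesis psi' : forall zeta tau, is_derive tau (1 : R) (psi^~ zeta) (dpsi tau zeta).
Hypothesis ipsi : forall tau, D.-integrable setT (EFin \o psi tau).
Hypothesis mdpsi : measurable_fun setT (fun z : R * Xi => dpsi z.1 z.2).
Hypothesis dpsiC : forall tau, 0 <= tau <= 1 ->
  (\int[D]_zeta (dpsi tau zeta ^+ 2)%:E <= C%:E)%E.

Let mdpsi1 tau : measurable_fun setT (dpsi tau).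
Proof.
apply: (measurableT_comp mdpsi (g := fun zeta => (tau, zeta))).
by apply: measurable_fun_pair; [exact: measurable_cst|exact: measurable_id].
Qed.

Let mdpsi2 zeta : measurable_fun setT (dpsi^~ zeta).
Proof.
apply: (measurableT_comp mdpsi (g := fun tau => (tau, zeta))).
by apply: measurable_fun_pair; [exact: measurable_id|exact: measurable_cst].
Qed.

(* Since [|y| <= K + y^2 / (4 K)], [W K h] bounds the excess over [K] of the
   difference quotient of step [h], and its mean is at most [C / (4 K)]. *)
Let W (K h : R) (zeta : Xi) : \bar R :=
  (\int[mu]_(tau in `[0%R, h]) (((4 * K)^-1 / h * dpsi tau zeta ^+ 2))%:E)%E.

Let quotient_le (K h : R) zeta : 0 < K -> 0 < h ->
  (`|h^-1 * (psi h zeta - psi 0 zeta)|%:E <= K%:E + W K h zeta)%E.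
Proof.
move=> K0 h0.
have := normr_increment_le_integral (ltW h0) (psi' zeta) (mdpsi2 zeta).
have mm (D' : set R) (c : R) :
    measurable_fun D' (fun tau => (c * dpsi tau zeta ^+ 2)%:E).
  apply: (@measurable_funTS _ _ _ _ D'); apply/measurable_EFinP.
  apply: measurable_funM; first exact: measurable_cst.
  by apply: measurable_funX; exact: mdpsi2.
have K4 : 0 < (4 * K)^-1 by rewrite invr_gt0 mulr_gt0.
have le1 : (\int[mu]_(tau in `[0%R, h]) `|dpsi tau zeta|%:E <=
    h%:E * (K%:E + W K h zeta))%E.
  apply: (@le_trans _ _ (\int[mu]_(tau in `[0%R, h])
      (K%:E + ((4 * K)^-1 * dpsi tau zeta ^+ 2)%:E))%E).
    apply: (ge0_le_integral mu (measurable_itv _)).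
    - by move=> x _; rewrite lee_fin.
    - apply: (@measurable_funTS _ _ _ _ _); apply/measurable_EFinP.
      by apply: measurableT_comp => //; exact: mdpsi2.
    - apply: emeasurable_funD; [exact: measurable_cst|exact: mm].
    - by move=> x _; rewrite -EFinD lee_fin normr_le_young.
  rewrite (ge0_integralD mu (measurable_itv _)); last 4 first.
  - by move=> x _; rewrite lee_fin ltW.
  - exact: measurable_cst.
  - by move=> x _; rewrite lee_fin mulr_ge0 ?sqr_ge0// ltW.
  - exact: mm.
  rewrite ge0_muleDr ?lee_fin ?(ltW K0)//; last first.
    apply: integral_ge0 => x _; rewrite lee_fin mulr_ge0 ?sqr_ge0//.
    by rewrite divr_ge0// ltW.
  have -> : (\int[mu]_(x in `[0%R, h]) K%:E = h%:E * K%:E)%E.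
    rewrite [LHS](integral_cst mu (measurable_itv _) K%:E).
    by rewrite [X in (_ * X)%E = _]lebesgue_measure_itv/= lte_fin h0 sube0 muleC.
  apply: leeD => //.
  rewrite /W -(ge0_integralZl_EFin mu (measurable_itv _)); last 3 first.
  - by move=> x _; rewrite lee_fin mulr_ge0 ?sqr_ge0// divr_ge0// ltW.
  - exact: mm.
  - exact: ltW.
  rewrite le_eqVlt; apply/orP; left; apply/eqP; apply: eq_integral => x _.
  by rewrite -EFinM; congr EFin; field; rewrite !gt_eqF.
move=> /le_trans/(_ le1) le2.
have hi : (0 <= h^-1%:E :> \bar R)%E by rewrite lee_fin invr_ge0 ltW.
have := lee_wpmul2l hi le2.
rewrite -EFinM muleA -EFinM mulVf ?gt_eqF// mul1e.
by rewrite normrM (gtr0_norm (_ : 0 < h^-1)) ?invr_gt0.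
Qed.

(** Tonelli: for each [tau] in [[0, h]] the mean of the squared derivative is at most [C], and the
    length [h] cancels the factor [1 / h]; the bound is uniform in [h]. *)
Let expectation_W (K h : R) : 0 < K -> 0 < h <= 1 ->
  measurable_fun setT (W K h) /\
  (\int[D]_zeta W K h zeta <= ((4 * K)^-1 * C)%:E)%E.
Proof.
move=> K0 /andP[h0 h1].
have c0 : 0 <= (4 * K)^-1 / h by rewrite divr_ge0 ?invr_ge0 ?mulr_ge0// ltW.
(* The indicator extends the integral over [[0, h]] to the whole line, as the product measure
   requires. *)
pose g (z : R * Xi) : \bar R :=
  ((4 * K)^-1 / h * dpsi z.1 z.2 ^+ 2 * \1_(`[0, h] : set R) z.1)%:E.
have g0 z : (0 <= g z)%E.
  by rewrite /g lee_fin; apply: mulr_ge0; rewrite ?indicE// mulr_ge0 ?sqr_ge0.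
have m1 : measurable_fun setT (\1_(`[0, h] : set R) : R -> R).
  by apply: measurable_indic; exact: measurable_itv.
have mg : measurable_fun setT g.
  apply/measurable_EFinP; apply: measurable_funM; last first.
    exact: (measurableT_comp m1 measurable_fst).
  apply: measurable_funM; first exact: measurable_cst.
  exact: measurable_funX.
have WE zeta : W K h zeta = (\int[mu]_tau g (tau, zeta))%E.
  rewrite /W integral_mkcond; apply: eq_integral => tau _.
  by rewrite /g patchE indicE/=; case: ifP => _; rewrite ?mulr1 ?mulr0.
split.
  rewrite (_ : W K h = fun zeta => \int[mu]_tau g (tau, zeta))%E; last exact/funext.
  exact: measurable_fun_fubini_tonelli_G.
under eq_integral do rewrite WE.
rewrite -(@fubini_tonelli _ _ _ _ _ mu D g mg g0).
rewrite (_ : (fun x => _) = (fun tau => \int[D]_y g (tau, y)))%E//.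
have bnd tau : (\int[D]_y g (tau, y) <=
    ((4 * K)^-1 / h * C)%:E * (\1_(`[0%R, h] : set R) tau)%:E)%E.
  have [th|th] := boolP (tau \in (`[0, h]%classic : set R)); last first.
    rewrite indicE (negPf th) mule0 integral0_eq// => y _.
    by rewrite /g/= indicE (negPf th) mulr0.
  rewrite indicE th mule1.
  under eq_integral do rewrite /g/= indicE th mulr1 EFinM.
  rewrite ge0_integralZl_EFin//; last 2 first.
  - by move=> y _; rewrite lee_fin sqr_ge0.
  - by apply/measurable_EFinP; apply: measurable_funX; exact: mdpsi1.
  rewrite [leRHS]EFinM lee_wpmul2l// dpsiC//.
  move: th; rewrite inE/= in_itv/= => /andP[-> th]/=.
  exact: le_trans h1.
have C0 : 0 <= C.
  rewrite -lee_fin; apply: (le_trans _ (dpsiC (tau := 0) _)); last by rewrite lexx/=.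
  by apply: integral_ge0 => y _; rewrite lee_fin sqr_ge0.
apply: (@le_trans _ _ (\int[mu]_tau
    (((4 * K)^-1 / h * C)%:E * (\1_(`[0%R, h] : set R) tau)%:E))%E).
  apply: ge0_le_integral => //.
  - by move=> x _; apply: integral_ge0.
  - exact: measurable_fun_fubini_tonelli_F.
  - apply: emeasurable_funM; first exact: measurable_cst.
    exact/measurable_EFinP.
rewrite ge0_integralZl_EFin//; last 2 first.
- exact/measurable_EFinP.
- by rewrite mulr_ge0.
have -> : (\int[mu]_tau (\1_(`[0%R, h] : set R) tau)%:E = h%:E)%E.
  rewrite integral_indic// setIT [LHS]lebesgue_measure_itv/= lte_fin h0.
  by rewrite sube0.
by rewrite -EFinM lee_fin mulrAC divfK ?gt_eqF.
Qed.

Let mtrunc K (f : Xi -> R) : measurable_fun setT f ->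
  measurable_fun setT (truncate K \o f).
Proof.
move=> mf; apply: measurable_minr; first exact: measurable_cst.
by apply: measurable_maxr; first exact: measurable_cst.
Qed.

Let itrunc K (f : Xi -> R) : 0 <= K -> measurable_fun setT f ->
  D.-integrable setT (EFin \o (truncate K \o f)).
Proof.
move=> K0 mf.
apply: (le_integrable measurableT (g := EFin \o cst K)).
- by apply/measurable_EFinP; exact: mtrunc.
- by move=> x _; rewrite /= lee_fin (ger0_norm K0) truncate_le.
- exact: finite_measure_integrable_cst.
Qed.

(** Truncation at [K] moves [f] pointwise by at most [B], hence its mean by at most that of [B]. *)
Let truncate_integral_le K c (f : Xi -> R) (B : Xi -> \bar R) : 0 <= K ->
  D.-integrable setT (EFin \o f) -> measurable_fun setT B ->
  (forall z, 0 <= B z)%E -> (forall z, `|f z|%:E <= K%:E + B z)%E ->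
  (\int[D]_z B z <= c%:E)%E ->
  `|\int[D]_z f z - \int[D]_z truncate K (f z)| <= c.
Proof.
move=> K0 fi mB B0 fB Bc.
have mf : measurable_fun setT f by apply/measurable_EFinP; exact: (measurable_int D fi).
have ti := itrunc K0 mf.
have fti : D.-integrable setT (EFin \o (fun z => f z - truncate K (f z))).
  exact: (integrableB measurableT fi ti).
rewrite -RintegralB//; apply: le_trans (le_normr_Rintegral measurableT fti) _.
rewrite -lee_fin /Rintegral fineK; last first.
  by apply: integrable_fin_num => //; exact: (integrable_norm fti).
apply: le_trans Bc; apply: ge0_le_integral => //.
  have /measurable_EFinP mfT := measurable_int D fti.
  by apply/measurable_EFinP; exact: measurableT_comp mfT.
move=> z _; have := fB z; have := B0 z; case: (B z) => [w||]//; last first.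
  by move=> *; rewrite leey.
by rewrite -EFinD !lee_fin => w0 fw; exact: truncate_error.
Qed.

(** The difference quotients tend to [dpsi 0] pointwise and their means to [v]. Their truncations at
    [K] pass to the limit by dominated convergence; truncating costs at most [C / (4 K)] on each
    side, uniformly in [n], and [K] is arbitrary. *)
Lemma expectation_derivative :
  is_derive (0 : R) (1 : R) (fun tau => fine ('E_D[psi tau])) v ->
  D.-integrable setT (EFin \o dpsi 0) /\ (\int[D]_z (dpsi 0 z)%:E = v%:E)%E.
Proof.
move=> dE.
have C0 : 0 <= C.
  rewrite -lee_fin; apply: (le_trans _ (dpsiC (tau := 0) _)); last by rewrite lexx/=.
  by apply: integral_ge0 => y _; rewrite lee_fin sqr_ge0.
have msqr c : measurable_fun setT (fun z => (c * dpsi 0 z ^+ 2)%:E).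
  apply/measurable_EFinP; apply: measurable_funM; first exact: measurable_cst.
  by apply: measurable_funX; exact: mdpsi1.
have sqrC K : 0 < K -> (\int[D]_z ((4 * K)^-1 * dpsi 0 z ^+ 2)%:E <=
    ((4 * K)^-1 * C)%:E)%E.
  move=> K0; under eq_integral do rewrite EFinM.
  rewrite ge0_integralZl_EFin//; last 3 first.
  - by move=> z _; rewrite lee_fin sqr_ge0.
  - by apply/measurable_EFinP; apply: measurable_funX; exact: mdpsi1.
  - by rewrite invr_ge0 mulr_ge0// ltW.
  rewrite EFinM lee_wpmul2l ?dpsiC ?lexx ?ler01//.
  by rewrite lee_fin invr_ge0 mulr_ge0// ltW.
have i0 : D.-integrable setT (EFin \o dpsi 0).
  apply/integrableP; split; first by apply/measurable_EFinP; exact: mdpsi1.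
  apply: (@le_lt_trans _ _ (1 + ((4 * 1)^-1 * C)%:E)%E); last by rewrite -EFinD ltry.
  apply: (@le_trans _ _ (\int[D]_z (1 + ((4 * 1)^-1 * dpsi 0 z ^+ 2)%:E))%E).
    apply: ge0_le_integral => //.
    - by apply: measurableT_comp => //; apply/measurable_EFinP; exact: mdpsi1.
    - by apply: emeasurable_funD; [exact: measurable_cst|exact: msqr].
    - by move=> z _; rewrite -EFinD lee_fin normr_le_young.
  rewrite ge0_integralD//; last first.
    by move=> z _; rewrite lee_fin mulr_ge0 ?sqr_ge0// invr_ge0 mulr1.
  rewrite integral_cst//= probability_setT mule1.
  by apply: leeD => //; exact: sqrC.
split=> //.
pose Y n z := n.+1%:R * (psi n.+1%:R^-1 z - psi 0 z).
have iB n : D.-integrable setT (EFin \o (fun z => psi n.+1%:R^-1 z - psi 0 z)).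
  exact: (integrableB measurableT (ipsi _) (ipsi _)).
have iY n : D.-integrable setT (EFin \o Y n) by exact: (integrableZl measurableT _ (iB n)).
have Ycvg z : Y n z @[n --> \oo] --> dpsi 0 z.
  have := is_derive_cvg_seq (psi' z 0).
  by under eq_fun do rewrite add0r.
have EY : (\int[D]_z Y n z) @[n --> \oo] --> v.
  move/is_derive_cvg_seq : dE; rewrite unlock; under eq_fun do rewrite add0r.
  apply: cvg_trans; apply: near_eq_cvg; apply: nearW => n.
  by rewrite RintegralZl// RintegralB.
have key K : 0 < K -> `|v - \int[D]_z dpsi 0 z| <= 2 * ((4 * K)^-1 * C).
  move=> K0; have K00 := ltW K0.
  have mY n : measurable_fun setT (Y n).
    by apply/measurable_EFinP; exact: (measurable_int D (iY n)).
  have h1 n : `|\int[D]_z Y n z - \int[D]_z truncate K (Y n z)| <= (4 * K)^-1 * C.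
    have n01 : 0 < (n.+1%:R^-1 : R) <= 1 by rewrite invr_gt0 ltr0n invf_le1// ler1n.
    have [mW WC] := expectation_W K0 n01.
    apply: (truncate_integral_le K00 (iY n) mW) => // z.
      apply: integral_ge0 => x _; rewrite lee_fin mulr_ge0 ?sqr_ge0//.
      by rewrite mulr_ge0 ?invr_ge0 ?mulr_ge0.
    have /andP[n0 _] := n01.
    by have := quotient_le z K0 n0; rewrite invrK.
  have h2 : `|\int[D]_z dpsi 0 z - \int[D]_z truncate K (dpsi 0 z)| <= (4 * K)^-1 * C.
    apply: (truncate_integral_le K00 i0 (msqr (4 * K)^-1)) => [z|z|]; last exact: sqrC.
      by rewrite lee_fin mulr_ge0 ?sqr_ge0// invr_ge0 mulr_ge0.
    by rewrite -EFinD lee_fin normr_le_young.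
  have h3 : (\int[D]_z truncate K (Y n z)) @[n --> \oo] -->
      \int[D]_z truncate K (dpsi 0 z).
    have it := itrunc K00 (mdpsi1 0).
    apply: fine_cvg; rewrite fineK; last exact: integrable_fin_num it.
    have m1 n : measurable_fun setT (fun z => (truncate K (Y n z))%:E).
      by apply/measurable_EFinP; exact: mtrunc.
    have m2 : measurable_fun setT (EFin \o (truncate K \o dpsi 0)).
      by apply/measurable_EFinP; exact: mtrunc.
    have [] // := dominated_convergence measurableT m1 m2 _
      (finite_measure_integrable_cst D K measurableT) _.
    - apply: aeW => z _ /=; apply: cvg_EFin; first exact: nearW.
      exact: (cvg_comp _ (truncate K) (Ycvg z) (@continuous_truncate _ K _)).
    - by apply: aeW => z n _; rewrite /= lee_fin truncate_le.
  have h4 : `|v - \int[D]_z truncate K (dpsi 0 z)| <= (4 * K)^-1 * C.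
    have h5 : `|\int[D]_z Y n z - \int[D]_z truncate K (Y n z)| @[n --> \oo] -->
        `|v - \int[D]_z truncate K (dpsi 0 z)|.
      exact: cvg_norm (cvgB EY h3).
    by rewrite -(cvg_lim _ h5)//; apply: limr_le; [apply/cvg_ex; eexists; exact: h5|exact: nearW].
  rewrite (le_trans (ler_distD (\int[D]_z truncate K (dpsi 0 z)) _ _))//.
  by rewrite (distrC (\int[D]_z truncate K (dpsi 0 z))); lra.
have -> : v = \int[D]_z dpsi 0 z.
  apply/eqP; rewrite -subr_eq0 -normr_le0; apply/ler_addgt0Pr => e e0.
  (* With this [K] the two errors [C / (4 K)] add up to [e C / (C + 1)]. *)
  have K0 : 0 < (C + 1) / (2 * e) by rewrite divr_gt0 ?mulr_gt0// ltr_wpDl.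
  rewrite add0r (le_trans (key _ K0))//.
  rewrite [leLHS](_ : _ = e * (C / (C + 1))); last first.
    by field; rewrite !gt_eqF// ltr_wpDl.
  by rewrite ger_pMr// ler_pdivrMr ?mul1r ?ltr_wpDl// lerDl.
by rewrite /Rintegral fineK//; exact: integrable_fin_num i0.
Qed.

End UnbiasedDerivative.

(** * Unbiasedness of the sampled gradient *)

Section UnbiasedGradient.
Context {R : realType} {d : nat} {dX : measure_display} {Xi : measurableType dX}.
Variables (D : probability Xi R) (F : 'rV[R]_d -> Xi -> R) (L delta : R).
Hypothesis iF : forall u, D.-integrable setT (EFin \o F u).
Hypothesis dF : forall zeta u, differentiable (F^~ zeta) u.
Hypothesis fL : lipschitz_gradient L (mean_loss D F).
Hypothesis vF : bounded_variance D F delta.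

Lemma measurable_loss u : measurable_fun setT (F u).
Proof. by apply/measurable_EFinP; exact: (measurable_int D (iF u)). Qed.

Lemma measurable_noise {dT : measure_display} {T : measurableType dT}
    (u : T -> 'rV[R]_d) j : (forall j, measurable_fun setT (fun t => u t 0 j)) ->
  measurable_fun setT (fun z : T * Xi =>
    (gradient (F^~ z.2) (u z.1) - gradient (mean_loss D F) (u z.1)) 0 j).
Proof.
move=> mu_; have [df _] := fL.
have coordB (A B : 'rV[R]_d) : (A - B) 0 j = A 0 j - B 0 j by rewrite !mxE.
under eq_fun do rewrite coordB.
apply: measurable_funB; first exact: measurable_gradient measurable_loss dF mu_.
(* The mean loss is a loss that ignores the sample. *)
apply: (measurable_gradient (F := fun v _ => mean_loss D F v)) mu_ => //.
Qed.

Lemma measurable_dotp {dT : measure_display} {T : measurableType dT}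
    (u v : T -> 'rV[R]_d) : (forall j, measurable_fun setT (fun t => u t 0 j)) ->
  (forall j, measurable_fun setT (fun t => v t 0 j)) ->
  measurable_fun setT (fun t => dotp (u t) (v t)).
Proof.
move=> mu_ mv; apply: measurable_sum => j.
by apply: measurable_funM; [exact: mu_|exact: mv].
Qed.

Lemma sqr_coord_le (v : 'rV[R]_d) j : v 0 j ^+ 2 <= dotp v v.
Proof.
rewrite /dotp (bigD1 j)//= -expr2 lerDl.
by apply: sumr_ge0 => i _; rewrite -expr2 sqr_ge0.
Qed.

Lemma expectation_noise_sqr_le u :
  (\int[D]_z (dotp (gradient (F^~ z) u - gradient (mean_loss D F) u)
                  (gradient (F^~ z) u - gradient (mean_loss D F) u))%:E
    <= (delta ^+ 2)%:E)%E.
Proof.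
have := vF u; rewrite unlock; apply: le_trans.
rewrite le_eqVlt; apply/orP; left; apply/eqP; apply: eq_integral => z _ /=.
by rewrite enorm_sqr -opprB dotpNl dotpNr opprK.
Qed.

Lemma gradient_unbiased u j :
  D.-integrable setT (fun z => (gradient (F^~ z) u 0 j)%:E) /\
  (\int[D]_z (gradient (F^~ z) u 0 j)%:E = (gradient (mean_loss D F) u 0 j)%:E)%E.
Proof.
pose e : 'rV[R]_d := delta_mx 0 j.
(* Twice the variance bound plus twice the squared mean gradient on the segment, which by the
   Lipschitz property is at most [2 L ^+ 2] plus twice its value at [u]. *)
pose C := 2 * delta ^+ 2 + 4 * dotp (gradient (mean_loss D F) u) (gradient (mean_loss D F) u)
  + 4 * L ^+ 2.
have ee : dotp e e = 1 by rewrite dotp_deltal mxE !eqxx.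
have mline : forall i, measurable_fun setT (fun t : R => (u + t *: e) 0 i).
  move=> i; under eq_fun do rewrite !mxE.
  apply: measurable_funD; first exact: measurable_cst.
  by apply: measurable_funM; [exact: measurable_id|exact: measurable_cst].
have psi' zeta tau : is_derive tau (1 : R) (fun t => F (u + t *: e) zeta)
    (gradient (F^~ zeta) (u + tau *: e) 0 j).
  by rewrite -dotp_deltar; exact: is_derive_line (dF zeta (u + tau *: e)).
have mdpsi : measurable_fun setT
    (fun z : R * Xi => gradient (F^~ z.2) (u + z.1 *: e) 0 j).
  exact: (measurable_gradient (u := fun t : R => u + t *: e) j measurable_loss dF mline).
have dpsiC tau : 0 <= tau <= 1 ->
    (\int[D]_zeta (gradient (F^~ zeta) (u + tau *: e) 0 j ^+ 2)%:E <= C%:E)%E.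
  move=> /andP[t0 t1]; set w := u + tau *: e; set f := mean_loss D F.
  have mn : measurable_fun setT (fun z => (dotp (gradient (F^~ z) w - gradient f w)
      (gradient (F^~ z) w - gradient f w))%:E).
    have h i : measurable_fun setT (fun z => (gradient (F^~ z) w - gradient f w) 0 i).
      have m1 := @measurable_noise _ R (fun=> w) i (fun=> @measurable_cst _ _ _ _ _ _).
      apply: (measurableT_comp m1 (g := fun z => (0 : R, z))).
      by apply: measurable_fun_pair; [exact: measurable_cst|exact: measurable_id].
    by apply/measurable_EFinP; exact: measurable_dotp.
  have fw : dotp (gradient f w) (gradient f w) <=
      2 * dotp (gradient f u) (gradient f u) + 2 * L ^+ 2.
    have -> : gradient f w = gradient f u + (gradient f w - gradient f u).
      by rewrite addrCA subrr addr0.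
    apply: (le_trans (dotp_sqrD _ _)); rewrite lerD2l ler_pM2l//.
    have [_ fl] := fL; have := dotp_le_enorm (fl w u).
    have -> : w - u = tau *: e by rewrite /w addrAC subrr add0r.
    rewrite dotpZl dotpZr ee mulr1 => /le_trans; apply.
    by rewrite ler_piMr ?sqr_ge0// mulr_ile1.
  apply: (@le_trans _ _ (\int[D]_z (2%:E * (dotp (gradient (F^~ z) w - gradient f w)
      (gradient (F^~ z) w - gradient f w))%:E +
      (2 * dotp (gradient f w) (gradient f w))%:E))%E).
    apply: ge0_le_integral => //.
    - by move=> z _; rewrite lee_fin sqr_ge0.
    - apply/measurable_EFinP; apply: measurable_funX.
      apply: (measurableT_comp mdpsi (g := fun z => (tau, z))).
      by apply: measurable_fun_pair; [exact: measurable_cst|exact: measurable_id].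
    - by apply: emeasurable_funD; [exact: measurable_funeM|exact: measurable_cst].
    move=> z _; rewrite -EFinM -EFinD lee_fin (le_trans (sqr_coord_le _ _))//.
    by have := dotp_sqrD (gradient (F^~ z) w - gradient f w) (gradient f w); rewrite subrK.
  rewrite ge0_integralD//; last 3 first.
  - by move=> z _; rewrite mule_ge0// lee_fin dotp_ge0.
  - exact: measurable_funeM.
  - by move=> z _; rewrite lee_fin mulr_ge0 ?dotp_ge0.
  rewrite integral_cst//= probability_setT mule1 ge0_integralZl_EFin//; last first.
    by move=> z _; rewrite lee_fin dotp_ge0.
  have two : (0 <= 2%:E :> \bar R)%E by rewrite lee_fin.
  have h := lee_wpmul2l two (expectation_noise_sqr_le w).
  apply: (le_trans (leeD2r _ h)).
  by rewrite -EFinM -EFinD lee_fin /C -/f; lra.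
have := @expectation_derivative R _ Xi D (fun t => F (u + t *: e))
  (fun t z => gradient (F^~ z) (u + t *: e) 0 j) C (gradient (mean_loss D F) u 0 j)
  psi' (fun t => iF _) mdpsi dpsiC.
rewrite scale0r addr0; apply.
have [df _] := fL; rewrite -dotp_deltar; exact: (is_derive_line0 e (df u)).
Qed.

End UnbiasedGradient.

(** * Sampling noise *)

Section ProductLaw.
Context {R : realType} {dO dT dX : measure_display}.
Context {Omega : measurableType dO} {T : measurableType dT} {Xi : measurableType dX}.
Variables (P : probability Omega R) (D : probability Xi R).
Variables (U : {mfun Omega >-> T}) (X : {mfun Omega >-> Xi}).
Hypothesis UX : forall A C, measurable A -> measurable C ->
  P (U @^-1` A `&` X @^-1` C) = (P (U @^-1` A) * D C)%E.

Let Z omega : T * Xi := (U omega, X omega).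

Let mZ : measurable_fun setT Z.
Proof. by apply: measurable_fun_pair; exact: measurable_funPT. Qed.

HB.instance Definition _ := isMeasurableFun.Build _ _ _ _ Z mZ.

Let law A : measurable A ->
  distribution P Z A = (distribution P U \x D)%E A.
Proof.
move=> mA; apply/esym; apply: product_measure_unique mA => B C mB mC.
by rewrite /distribution /pushforward -UX.
Qed.

(** By independence the joint law is a product, so Tonelli averages the sample first, with [U]
    frozen. *)
Lemma ge0_integral_product_law (g : T * Xi -> \bar R) :
  measurable_fun setT g -> (forall z, 0 <= g z)%E ->
  (\int[P]_omega g (U omega, X omega) =
   \int[P]_omega \int[D]_zeta g (U omega, zeta))%E.
Proof.
move=> mg g0.
have := @ge0_integral_distribution _ _ _ _ _ P Z g mg g0.
rewrite /comp => <-.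
rewrite (eq_measure_integral (distribution P U \x D)%E) => [|A mA _]; last exact: law.
rewrite fubini_tonelli1// (@ge0_integral_distribution _ _ _ _ _ P U)//.
  exact: measurable_fun_fubini_tonelli_F.
by move=> y; apply: integral_ge0.
Qed.

(** Integrability is transported from [P] to the product law, where Fubini averages the sample
    first. *)
Lemma integral_product_law_eq0 (g : T * Xi -> \bar R) :
  measurable_fun setT g -> P.-integrable setT (fun omega => g (U omega, X omega)) ->
  (forall t, \int[D]_zeta g (t, zeta) = 0)%E ->
  (\int[P]_omega g (U omega, X omega) = 0)%E.
Proof.
move=> mg ig g0.
have := @integral_distribution _ _ _ _ _ P Z g mg ig.
rewrite /comp => <-.
rewrite (eq_measure_integral (distribution P U \x D)%E) => [|A mA _]; last exact: law.
have iprod : (distribution P U \x D)%E.-integrable setT g.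
  apply/integrableP; split => //.
  rewrite -(eq_measure_integral (distribution P U \x D)%E (m1 := distribution P Z));
    last by move=> A mA _; exact: law.
  rewrite (@ge0_integral_distribution _ _ _ _ _ P Z (abse \o g))//.
  - by case/integrableP : ig.
  - exact: measurableT_comp mg.
  - by move=> y; exact: abse_ge0.
rewrite -(integral12_prod_meas1 iprod) /fubini_F.
by rewrite integral0_eq// => t _; exact: g0.
Qed.

End ProductLaw.

Section SubSigmaAlgebra.
Context {dO : measure_display} {Omega : measurableType dO}.
Variable H : set (set Omega).
Hypothesis sH : sigma_algebra setT H.

Lemma measurable_sub (A : set (g_sigma_algebraType H)) : measurable A -> H A.
Proof. by rewrite measurable_g_measurableTypeE. Qed.

(** Equipping [Omega] with [H] itself makes the general measurability lemmas available for adapted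
    functions. *)
Lemma measurable_wrtP d (T : measurableType d) (f : Omega -> T) :
  measurable_wrt H f <->
  measurable_fun setT (f : g_sigma_algebraType H -> T).
Proof.
split=> [h _ B mB|h C mC].
  by rewrite setTI; apply: sub_sigma_algebra; exact: h.
by have := h measurableT C mC; rewrite setTI => /measurable_sub.
Qed.

Lemma rV_measurable_wrtP {R : realType} n (v : Omega -> 'rV[R]_n) :
  rV_measurable_wrt H v <->
  forall j, measurable_fun setT (fun t : g_sigma_algebraType H => v t 0 j).
Proof. by split=> h j; apply/measurable_wrtP; exact: h. Qed.

Hypothesis HO : H `<=` measurable.

Lemma measurable_wrt_measurable d (T : measurableType d) (f : Omega -> T) :
  measurable_wrt H f -> measurable_fun setT f.
Proof. by move=> h _ B mB; rewrite setTI; apply: HO; exact: h. Qed.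

Lemma measurable_id_sub :
  measurable_fun setT (fun omega : Omega => omega : g_sigma_algebraType H).
Proof.
move=> _ B mB; rewrite setTI; apply: HO; exact: measurable_sub.
Qed.

End SubSigmaAlgebra.

(** * Noise of a sample independent of the history *)

Section SampledNoise.
Context {R : realType} {d : nat} {dO dX : measure_display}.
Context {Omega : measurableType dO} {Xi : measurableType dX}.
Variables (P : probability Omega R) (D : probability Xi R).
Variables (F : 'rV[R]_d -> Xi -> R) (L delta : R).
Hypothesis iF : forall u, D.-integrable setT (EFin \o F u).
Hypothesis dF : forall zeta u, differentiable (F^~ zeta) u.
Hypothesis fL : lipschitz_gradient L (mean_loss D F).
Hypothesis vF : bounded_variance D F delta.
Variables (H H' : set (set Omega)) (X : Omega -> Xi) (u : Omega -> 'rV[R]_d).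
Hypotheses (sH : sigma_algebra setT H) (sH' : sigma_algebra setT H').
Hypotheses (HO : H `<=` measurable) (HO' : H' `<=` measurable) (HH' : H `<=` H').
Hypotheses (mX : measurable_wrt H' X) (lX : forall C, measurable C -> P (X @^-1` C) = D C).
Hypothesis indX : independent_of P H X.
Hypothesis mu_ : rV_measurable_wrt H u.

Definition noise omega : 'rV[R]_d :=
  gradient (F^~ (X omega)) (u omega) - gradient (mean_loss D F) (u omega).

Let OH : measurableType _ := g_sigma_algebraType H.
Let n (z : OH * Xi) : 'rV[R]_d :=
  gradient (F^~ z.2) (u z.1) - gradient (mean_loss D F) (u z.1).

Let muH j : measurable_fun setT (fun t : OH => u t 0 j).
Proof. exact: (rV_measurable_wrtP sH u).1. Qed.

Let mn j : measurable_fun setT (fun z : OH * Xi => n z 0 j).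
Proof. exact: (measurable_noise iF dF fL). Qed.

Let mXO : measurable_fun setT X.
Proof. exact: (measurable_wrt_measurable HO' mX). Qed.

HB.instance Definition _ := isMeasurableFun.Build _ _ _ _ X mXO.
(* The history up to time [k] is encoded by the identity map into [Omega]
   equipped with the coarser sigma-algebra [H]. *)
Let idH (omega : Omega) : OH := omega.
HB.instance Definition _ := isMeasurableFun.Build _ _ _ _ idH (measurable_id_sub sH HO).

Let UX A C : measurable A -> measurable C ->
  P (idH @^-1` A `&` X @^-1` C) = (P (idH @^-1` A) * D C)%E.
Proof.
move=> mA mC; rewrite indX ?lX//; exact: measurable_sub mA.
Qed.

Let mdn : measurable_fun setT (fun z : OH * Xi => (dotp (n z) (n z))%:E).
Proof. by apply/measurable_EFinP; exact: measurable_dotp. Qed.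

Let mpair : measurable_fun setT (fun omega : Omega => (idH omega, X omega)).
Proof. by apply: measurable_fun_pair; exact: measurable_funPT. Qed.

(** The variance bound holds at every fixed point, hence at the random point [u], frozen by the
    history while the sample is averaged. *)
Lemma expectation_noise_sqr :
  (\int[P]_omega (dotp (noise omega) (noise omega))%:E <= (delta ^+ 2)%:E)%E.
Proof.
have := @ge0_integral_product_law _ _ _ _ _ _ _ P D idH X UX _ mdn.
rewrite /n/= => -> => [|z]; last by rewrite lee_fin dotp_ge0.
apply: (@le_trans _ _ (\int[P]_omega (delta ^+ 2)%:E)%E); last first.
  by rewrite integral_cst//= probability_setT mule1.
apply: ge0_le_integral => //.
- by move=> t _; apply: integral_ge0 => z _; rewrite lee_fin dotp_ge0.
- have m1 : measurable_fun setT
      (fun t : OH => \int[D]_z (dotp (n (t, z)) (n (t, z)))%:E)%E.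
    apply: (@measurable_fun_fubini_tonelli_F _ _ _ _ _ D _ mdn) => z.
    by rewrite lee_fin dotp_ge0.
  exact: (measurableT_comp m1 (measurable_id_sub sH HO)).
- by move=> t _; exact: expectation_noise_sqr_le.
Qed.

Lemma integrable_noise_sqr :
  P.-integrable setT (fun omega => (dotp (noise omega) (noise omega))%:E).
Proof.
apply/integrableP; split; first exact: (measurableT_comp mdn mpair).
under eq_integral do rewrite gee0_abs ?lee_fin ?dotp_ge0//.
by rewrite (le_lt_trans expectation_noise_sqr)// ltry.
Qed.

Let mdot (c : 'rV[R]_d) :
  measurable_fun setT (fun z : OH * Xi => (dotp (n z) (u z.1 - c))%:E).
Proof.
apply/measurable_EFinP; apply: measurable_dotp => // j.
under eq_fun do rewrite !mxE.
apply: measurable_funD; last exact: measurable_cst.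
exact: (measurableT_comp (muH j) measurable_fst).
Qed.

Lemma integrable_noise_dotp (c : 'rV[R]_d) :
  P.-integrable setT (fun omega => (dotp (u omega - c) (u omega - c))%:E) ->
  P.-integrable setT (fun omega => (dotp (noise omega) (u omega - c))%:E).
Proof.
move=> iu.
apply: (le_integrable measurableT (g := fun omega =>
  ((dotp (noise omega) (noise omega))%:E + (dotp (u omega - c) (u omega - c))%:E)%E)).
- exact: (measurableT_comp (mdot c) mpair).
- move=> omega _; rewrite -EFinD /= lee_fin.
  rewrite [leRHS]ger0_norm ?addr_ge0 ?dotp_ge0//.
  have h1 := dotp_sqrD (noise omega) (u omega - c).
  have := dotp_ge0 (noise omega + (u omega - c)).
  have := dotp_ge0 (noise omega - (u omega - c)).
  have := dotp_ge0 (noise omega); have := dotp_ge0 (u omega - c).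
  move: (noise omega) (u omega - c) => a b.
  rewrite !dotpE (dotpC b a) ler_norml => *; apply/andP; split; lra.
- exact: (integrableD measurableT integrable_noise_sqr iu).
Qed.

(** The noise is a martingale difference: [u - c] is frozen with the history, and
    [gradient_unbiased] cancels each coordinate of the mean over the sample. *)
Lemma expectation_noise_dotp (c : 'rV[R]_d) :
  P.-integrable setT (fun omega => (dotp (u omega - c) (u omega - c))%:E) ->
  (\int[P]_omega (dotp (noise omega) (u omega - c))%:E = 0)%E.
Proof.
move=> iu.
apply: (@integral_product_law_eq0 _ _ _ _ _ _ _ P D idH X UX _ (mdot c)).
  exact: integrable_noise_dotp.
move=> t; rewrite /n/=; set v := u t - c; set f := mean_loss D F.
have gi j := gradient_unbiased iF dF fL vF (u t) j.
have coordB (A B : 'rV[R]_d) j : (A - B) 0 j = A 0 j - B 0 j by rewrite !mxE.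
pose h j z := ((v 0 j)%:E * ((gradient (F^~ z) (u t) 0 j)%:E
   - (gradient f (u t) 0 j)%:E))%E.
have icst j : D.-integrable setT (fun _ : Xi => (gradient f (u t) 0 j)%:E).
  exact: (finite_measure_integrable_cst D (gradient f (u t) 0 j) measurableT).
have hi j : D.-integrable setT (h j).
  apply: integrableZl => //; apply: integrableB => //.
  by have [] := gi j.
have -> : (\int[D]_z (dotp (gradient (F^~ z) (u t) - gradient f (u t)) v)%:E =
    \int[D]_z \sum_(j < d) h j z)%E.
  apply: eq_integral => z _; rewrite /dotp -sumEFin; apply: eq_bigr => j _.
  by rewrite coordB /h -EFinB -EFinM mulrC.
rewrite integral_sum//; apply: big1 => j _.
rewrite integralZl//; last by apply: integrableB => //; have [] := gi j.
rewrite integralB//; last by have [] := gi j.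
have [_ ->] := gi j.
by rewrite integral_cst//= probability_setT mule1 subee// mule0.
Qed.

(** History and current sample are both known to [H']; this keeps the iterates adapted. *)
Lemma sampled_gradient_measurable j :
  measurable_wrt H' (fun omega => gradient (F^~ (X omega)) (u omega) 0 j).
Proof.
apply/(measurable_wrtP sH').
have m1 : measurable_fun setT (fun omega : g_sigma_algebraType H' => (idH omega, X omega)).
  apply: measurable_fun_pair; last exact/(measurable_wrtP sH').
  move=> _ B mB; rewrite setTI; apply: sub_sigma_algebra; apply: HH'.
  exact: measurable_sub mB.
have m2 := measurable_gradient j (measurable_loss iF) dF muH.
exact: (measurableT_comp m2 m1).
Qed.

End SampledNoise.

Section AdaptedVectors.
Context {R : realType} {d : nat} {dO : measure_display} {Omega : measurableType dO}.
Variable H : set (set Omega).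
Hypothesis sH : sigma_algebra setT H.
Implicit Types u v : Omega -> 'rV[R]_d.

Lemma rV_measurable_wrtW (H0 : set (set Omega)) u : H0 `<=` H ->
  rV_measurable_wrt H0 u -> rV_measurable_wrt H u.
Proof. by move=> H0H hu j C mC; apply: H0H; exact: hu. Qed.

Lemma rV_measurable_wrtD u v : rV_measurable_wrt H u -> rV_measurable_wrt H v ->
  rV_measurable_wrt H (fun omega => u omega + v omega).
Proof.
move=> /(rV_measurable_wrtP sH) hu /(rV_measurable_wrtP sH) hv.
apply/(rV_measurable_wrtP sH) => j; under eq_fun do rewrite mxE.
by apply: measurable_funD; [exact: hu|exact: hv].
Qed.

Lemma rV_measurable_wrtZ (a : R) u : rV_measurable_wrt H u ->
  rV_measurable_wrt H (fun omega => a *: u omega).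
Proof.
move=> /(rV_measurable_wrtP sH) hu.
apply/(rV_measurable_wrtP sH) => j; under eq_fun do rewrite mxE.
by apply: measurable_funM; [exact: measurable_cst|exact: hu].
Qed.

Lemma rV_measurable_wrtB u v : rV_measurable_wrt H u -> rV_measurable_wrt H v ->
  rV_measurable_wrt H (fun omega => u omega - v omega).
Proof.
move=> hu hv; under eq_fun do rewrite -scaleN1r.
by apply: rV_measurable_wrtD => //; exact: rV_measurable_wrtZ.
Qed.

Lemma rV_measurable_wrt_cst (c : 'rV[R]_d) : rV_measurable_wrt H (fun=> c).
Proof. by apply/(rV_measurable_wrtP sH) => j; exact: measurable_cst. Qed.

Lemma rV_measurable_wrt_sum (I : finType) (A : {set I}) (u : I -> Omega -> 'rV[R]_d) :
  (forall i, i \in A -> rV_measurable_wrt H (u i)) ->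
  rV_measurable_wrt H (fun omega => \sum_(i in A) u i omega).
Proof.
move=> hu.
have -> : (fun omega => \sum_(i in A) u i omega) = \sum_(i in A) u i.
  by apply/funext => omega; rewrite fct_sumE.
apply: (big_ind (fun v => rV_measurable_wrt H v)) => //.
- exact: rV_measurable_wrt_cst.
- by move=> ? ?; exact: rV_measurable_wrtD.
Qed.

Lemma rV_measurable_wrt_gradient (f : 'rV[R]_d -> R) u :
  (forall y, differentiable f y) -> rV_measurable_wrt H u ->
  rV_measurable_wrt H (fun omega => gradient f (u omega)).
Proof.
move=> df /(rV_measurable_wrtP sH) hu; apply/(rV_measurable_wrtP sH) => j.
pose OH : measurableType _ := g_sigma_algebraType H.
have m := @measurable_gradient _ _ _ _ OH OH (fun y _ => f y) u j
  (fun y => measurable_cst _) (fun _ => df) hu.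
have m2 : measurable_fun setT
    (fun t : g_sigma_algebraType H => (t, t)).
  by apply: measurable_fun_pair; exact: measurable_id.
exact: (measurableT_comp m m2).
Qed.

End AdaptedVectors.

(** * Convergence of the iterates *)

Section Recursion.
Context {R : realType}.

(** Induction with [n = k + 1]: the condition on [D1] absorbs the [D0] term and leaves
    [D1 / n - D1 / n^2], at most [D1 / (n + 1)]. As [eta abar > 1], the contraction of the residual
    [abar D2] offsets the bias added at each step. *)
Lemma step_size_recursion (E : nat -> R) (k0 : nat) (abar eta D0 D1 D2 : R) :
  0 < abar -> 1 < eta * abar -> 0 <= D0 -> 0 <= D2 ->
  (forall k, (k0 <= k)%N -> abar / k.+1%:R * eta <= 1) ->
  (forall k, (k0 <= k)%N -> E k.+1 <= (1 - abar / k.+1%:R * eta) * E k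
     + (abar / k.+1%:R) ^+ 2 * D0 + abar / k.+1%:R * D2) ->
  abar ^+ 2 * D0 / (eta * abar - 1) <= D1 ->
  E k0 <= D1 / k0.+1%:R ->
  forall k, (k0 <= k)%N -> E k <= D1 / k.+1%:R + abar * D2.
Proof.
move=> ab0 eab D00 D20 hstep hE hD1 hk0.
have eab0 : 0 < eta * abar - 1 by rewrite subr_gt0.
have hD1' : abar ^+ 2 * D0 <= (eta * abar - 1) * D1.
  by rewrite -ler_pdivrMl// mulrC.
have D10 : 0 <= D1.
  by apply: le_trans hD1; rewrite divr_ge0 ?mulr_ge0 ?sqr_ge0// ltW.
have ge k : (k0 <= k)%N -> E k <= D1 / k.+1%:R + abar * D2.
  elim: k => [|k IH].
    rewrite leqn0 => /eqP k00; rewrite k00 in hk0.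
    by rewrite (le_trans hk0)// lerDl mulr_ge0// ltW.
  rewrite leq_eqVlt => /predU1P[<-|].
    by rewrite (le_trans hk0)// lerDl mulr_ge0// ltW.
  rewrite ltnS => kk; have {}IH := IH kk.
  apply: (le_trans (hE k kk)).
  have h0 : 0 <= 1 - abar / k.+1%:R * eta by rewrite subr_ge0 hstep.
  have := ler_wpM2l h0 IH => h.
  set n : R := k.+1%:R in h h0 *.
  have n0 : 0 < n by rewrite /n ltr0n.
  have -> : k.+2%:R = n + 1 :> R by rewrite /n natr1.
  have e1 : (abar / n) ^+ 2 * D0 <= (eta * abar - 1) * D1 / n ^+ 2.
    by rewrite expr_div_n mulrAC ler_pM2r ?invr_gt0 ?exprn_gt0.
  have e2 : abar / n * D2 <= (eta * abar) * (abar / n * D2).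
    have x0 : 0 <= abar / n * D2.
      by rewrite mulr_ge0// divr_ge0 ?(ltW ab0) ?(ltW n0).
    by rewrite ler_peMl// ltW.
  have e3 : D1 / n - D1 / n ^+ 2 <= D1 / (n + 1).
    have -> : D1 / n - D1 / n ^+ 2 = D1 * ((n - 1) / n ^+ 2) by field; rewrite gt_eqF.
    rewrite ler_wpM2l// ler_pdivrMr ?exprn_gt0// mulrC ler_pdivlMr ?addr_gt0//.
    by rewrite mulrDr mulr1 mulrBl mul1r; lra.
  apply: (le_trans (lerD (lerD h e1) (lexx _))).
  have -> : (1 - abar / n * eta) * (D1 / n + abar * D2) =
     D1 / n - eta * abar * D1 / n ^+ 2 + abar * D2 - eta * abar * (abar / n * D2).
    by field; rewrite gt_eqF.
  have -> : (eta * abar - 1) * D1 / n ^+ 2 = eta * abar * D1 / n ^+ 2 - D1 / n ^+ 2.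
    by field; rewrite gt_eqF.
  move: e2 e3; move: (eta * abar * (abar / n * D2)) (abar / n * D2).
  move: (D1 / (n + 1)) (eta * abar * D1 / n ^+ 2) (D1 / n ^+ 2) (D1 / n).
  by move=> *; lra.
exact: ge.
Qed.

End Recursion.

Section ExpectationStep.
Context {R : realType} {dO : measure_display} {Omega : measurableType dO}.
Variable P : probability Omega R.
Local Notation integrable h := (P.-integrable setT (EFin \o h)).

Lemma integrable_Rintegral_sum (J : finType) (A : {set J}) (h : J -> Omega -> R) :
  (forall i, i \in A -> integrable (h i)) ->
  integrable (fun omega => \sum_(i in A) h i omega) /\
  \int[P]_omega (\sum_(i in A) h i omega) = \sum_(i in A) \int[P]_omega h i omega.
Proof.
move=> hi.
have -> : (fun omega => \sum_(i in A) h i omega) = \sum_(i in A) h i.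
  by apply/funext => omega; rewrite fct_sumE.
apply: (big_rec2 (fun (F : Omega -> R) s => integrable F /\ Rintegral P setT F = s)).
  split; last by rewrite Rintegral_cst// mul0r.
  exact: (finite_measure_integrable_cst P 0 measurableT).
move=> i F s iA [iF <-]; split; first exact: (integrableD measurableT (hi i iA) iF).
by rewrite RintegralD//; exact: hi.
Qed.

(** Since [V'] is nonnegative, the pointwise bound is a domination: integrability passes to the next
    step together with the inequality. *)
Lemma expectation_step (J : finType) (A : {set J}) (V V' : Omega -> R)
    (N M : J -> Omega -> R) (delta : J -> R) (a c al : R) :
  integrable V -> measurable_fun setT V' -> (forall omega, 0 <= V' omega) ->
  (forall i, i \in A -> integrable (N i)) ->
  (forall i, i \in A -> (\int[P]_omega (N i omega)%:E <= (delta i ^+ 2)%:E)%E) ->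
  (forall i, i \in A -> integrable (M i)) ->
  (forall i, i \in A -> (\int[P]_omega (M i omega)%:E = 0)%E) ->
  (forall omega, V' omega <= a * V omega + c
     + \sum_(i in A) (2 * al ^+ 2 * N i omega - 2 * al * M i omega)) ->
  integrable V' /\
  \int[P]_omega V' omega <=
    a * \int[P]_omega V omega + c + 2 * al ^+ 2 * \sum_(i in A) delta i ^+ 2.
Proof.
move=> iV mV' V'0 iN NE iM ME hV'.
have iZ b h : integrable h -> integrable (fun omega => b * h omega).
  by move=> ih; exact: (integrableZl measurableT b ih).
have iNM i : i \in A ->
    integrable (fun omega => 2 * al ^+ 2 * N i omega - 2 * al * M i omega).
  move=> iA.
  exact: (integrableB measurableT (iZ _ _ (iN i iA)) (iZ _ _ (iM i iA))).
have [iS ES] := integrable_Rintegral_sum iNM.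
have iaV : integrable (fun omega => a * V omega + c).
  have ic := finite_measure_integrable_cst P c measurableT.
  exact: (integrableD measurableT (iZ a V iV) ic).
have iW := integrableD measurableT iaV iS.
have iV' : integrable V'.
  apply: (le_integrable measurableT _ _ iW); first exact/measurable_EFinP.
  move=> omega _; rewrite /= lee_fin ger0_norm//.
  by apply: le_trans (hV' omega) _; exact: ler_norm.
split=> //.
apply: (le_trans (le_Rintegral measurableT iV' iW (fun omega _ => hV' omega))).
rewrite RintegralD// ES; apply: lerD.
  rewrite RintegralD//; [|exact: iZ|]; last first.
    exact: (finite_measure_integrable_cst P c measurableT).
  by rewrite RintegralZl// Rintegral_cst//= probability_setT mulr1.
rewrite mulr_sumr; apply: ler_sum => i iA.
rewrite RintegralB//; [|by apply: iZ; exact: iN|by apply: iZ; exact: iM].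
rewrite !RintegralZl ?iN ?iM//.
have c0 : 0 <= 2 * al ^+ 2 by rewrite mulr_ge0 ?sqr_ge0.
rewrite /Rintegral (ME i iA)/= mulr0 subr0; apply: (ler_wpM2l c0).
by rewrite -lee_fin fineK ?NE//; exact: integrable_fin_num (iN i iA).
Qed.

End ExpectationStep.

Section StackError.
Context {R : realType} {d m : nat} {dO : measure_display} {Omega : measurableType dO}.
Variables (I : {set 'I_m}) (x : 'I_m -> Omega -> 'rV[R]_d) (x0 : Omega -> 'rV[R]_d).
Hypothesis mx : forall i, i \in I -> rV_measurable_wrt measurable (x i).
Hypothesis mx0 : rV_measurable_wrt measurable x0.

Lemma stack_sqdistE (y : 'I_m -> 'rV[R]_d) y0 (c : 'I_m -> 'rV[R]_d) c0 :
  stack_sqdist I y y0 c c0 =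
  \sum_(i in I) dotp (y i - c i) (y i - c i) + dotp (y0 - c0) (y0 - c0).
Proof. by rewrite /stack_sqdist enorm_sqr; under eq_bigr do rewrite enorm_sqr. Qed.

Lemma stack_sqdist_ge0 (y : 'I_m -> 'rV[R]_d) y0 (c : 'I_m -> 'rV[R]_d) c0 :
  0 <= stack_sqdist I y y0 c c0.
Proof.
by rewrite stack_sqdistE addr_ge0 ?dotp_ge0//; apply: sumr_ge0 => i _; exact: dotp_ge0.
Qed.

Lemma measurable_sqdist (u : Omega -> 'rV[R]_d) c : rV_measurable_wrt measurable u ->
  measurable_fun setT (fun omega => dotp (u omega - c) (u omega - c)).
Proof.
move=> mu_; have muc j : measurable_fun setT (fun omega => (u omega - c) 0 j).
  under eq_fun do rewrite !mxE.
  apply: measurable_funD; last exact: measurable_cst.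
  by move=> _ B mB; rewrite setTI; exact: mu_.
exact: measurable_dotp.
Qed.

Lemma measurable_stack_sqdist (c : 'I_m -> 'rV[R]_d) c0 :
  measurable_fun setT (fun omega => stack_sqdist I (x^~ omega) (x0 omega) c c0).
Proof.
under eq_fun do rewrite stack_sqdistE.
apply: measurable_funD; last exact: measurable_sqdist.
(* Measurability is known for indices in [I] only, so the sum is extended by zero. *)
pose h i omega := if i \in I then dotp (x i omega - c i) (x i omega - c i) else 0.
rewrite (_ : (fun _ => _) = fun omega => \sum_i h i omega).
  apply: measurable_sum => i; rewrite /h.
  case: (boolP (i \in I)) => iI; [exact: measurable_sqdist (mx iI)|exact: measurable_cst].
by apply/funext => omega; rewrite big_mkcond.
Qed.

End StackError.

Section RSAStep.
Context {R : realType} {d : nat}.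

(** Adding and subtracting the mean gradients [gf] at the iterate and [gs] at the minimizer exhibits
    the three parts of [gradient_step_le]: cocoercive difference, penalty, noise. For the master,
    the Byzantine sum takes the place of the noise. *)
Lemma regular_step_split (x xs g gf gs s : 'rV[R]_d) (a l : R) :
  x - a *: (g + l *: s) - xs =
  (x - xs) - a *: ((gf - gs) + (l *: s + gs) + (g - gf)).
Proof. by apply/rowP => j; rewrite !mxE; ring. Qed.

Lemma master_step_split (x xs g gs w t : 'rV[R]_d) (a l : R) :
  x - a *: (g + l *: (w + t)) - xs =
  (x - xs) - a *: ((g - gs) + (l *: w + gs) + l *: t).
Proof. by apply/rowP => j; rewrite !mxE; ring. Qed.

Lemma coord_sum_le (J : finType) (A : {set J}) (w : J -> 'rV[R]_d) j :
  (forall i, i \in A -> `|w i 0 j| <= 1) -> `|(\sum_(i in A) w i) 0 j| <= #|A|%:R.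
Proof.
move=> h; rewrite summxE (le_trans (ler_norm_sum _ _ _))//.
by rewrite -sumr_const; apply: ler_sum.
Qed.

Lemma coord_scaleD_le (s g : 'rV[R]_d) (l a b c : R) j : 0 <= l ->
  `|s 0 j| <= a -> `|g 0 j| <= b -> l * a + b = c ->
  `|(l *: s + g) 0 j| <= c.
Proof.
move=> l0 sa gb <-; rewrite !mxE (le_trans (ler_normD _ _))// lerD//.
by rewrite normrM (ger0_norm l0) ler_wpM2l.
Qed.

End RSAStep.

Theorem theorem3 (R : realType) (d m : nat) (d_gt0 : (0 < d)%N)
  (Byz : {set 'I_m})
  (dO dX : measure_display)
  (Omega : measurableType dO) (P : probability Omega R)
  (Xi : measurableType dX) (D : 'I_m -> probability Xi R)
  (F : 'rV[R]_d -> Xi -> R) (f0 : 'rV[R]_d -> R)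
  (p b : \bar R) (lambda : R)
  (mu L delta : 'I_m -> R) (mu0 L0 epsilon alpha_bar : R)
  (xt : 'rV[R]_d)
  (xs : 'I_m -> 'rV[R]_d) (xs0 : 'rV[R]_d)
  (G : nat -> set (set Omega))
  (xi : 'I_m -> nat -> Omega -> Xi)
  (z s w t x : 'I_m -> nat -> Omega -> 'rV[R]_d)
  (x0 : nat -> Omega -> 'rV[R]_d)
  (k0 : nat) :
  let Reg : {set 'I_m} := finset.setC Byz in
  let r : R := #|Reg|%:R in
  let q : R := #|Byz|%:R in
  let f : 'I_m -> 'rV[R]_d -> R := fun i => mean_loss (D i) F in
  let eta : R :=
    \big[Num.min/(2 * mu0 * L0 / (mu0 + L0) - epsilon)]_(i in Reg)
      (2 * mu i * L i / (mu i + L i)) in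
  let alpha_low : R :=
    \big[Num.min/(1 / (2 * (mu0 + L0)))]_(i in Reg)
      (1 / (2 * (mu i + L i))) in
  let alpha : nat -> R := fun k =>
    Num.min alpha_low (alpha_bar / k%:R) in
  let Delta0 : R :=
    16 * lambda ^+ 2 * r * d%:R + 16 * lambda ^+ 2 * r ^+ 2 * d%:R
    + 2 * lambda ^+ 2 * q ^+ 2 * d%:R + 2 * \sum_(i in Reg) delta i ^+ 2 in
  let Delta2 : R := lambda ^+ 2 * q ^+ 2 * d%:R / epsilon in
  let Delta1 : \bar R :=
    Order.max
      (alpha_bar ^+ 2 * Delta0 / (eta * alpha_bar - 1))%:E
      (k0.+1%:R%:E *
         'E_P[fun omega =>
                stack_sqdist Reg (fun i => x i k0 omega) (x0 k0 omega) xs xs0]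
       + (alpha_bar ^+ 2 * Delta0 / k0.+1%:R)%:E)%E in
  let lambda0 : R :=
    \big[Num.max/0]_(i in Reg) lpnorm b (gradient (f i) xt) in
  let err : nat -> \bar R := fun k =>
    ('E_P[fun omega =>
            stack_sqdist Reg (fun i => x i k omega) (x0 k omega)
                             (fun=> xt) xt])%E in
  (1 <= p)%E -> (p^-1 + b^-1 = 1)%E -> 0 < lambda ->
  (forall i u, (D i).-integrable setT (EFin \o F u)) ->
  (forall zeta u, differentiable (F^~ zeta) u) ->
  (forall i, 0 < mu i) -> 0 < mu0 ->
  (forall i, strongly_convex (mu i) (f i)) -> strongly_convex mu0 f0 ->
  (forall i, lipschitz_gradient (L i) (f i)) -> lipschitz_gradient L0 f0 ->
  filtration G ->
  (forall i, iid_sampling P G (D i) (xi i)) ->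
  (forall i, bounded_variance (D i) F (delta i)) ->
  (forall y : 'rV[R]_d,
     \sum_(i in Reg) f i xt + f0 xt <= \sum_(i in Reg) f i y + f0 y) ->
  (forall (y : 'I_m -> 'rV[R]_d) (y0 : 'rV[R]_d),
     \sum_(i in Reg) (f i (xs i) + lambda * lpnorm p (xs i - xs0)) + f0 xs0
     <= \sum_(i in Reg) (f i (y i) + lambda * lpnorm p (y i - y0)) + f0 y0) ->
  (forall i, i \in Reg -> rV_measurable_wrt (G 0%N) (x i 0%N)) ->
  rV_measurable_wrt (G 0%N) (x0 0%N) ->
  (forall i k, i \in Reg ->
     rV_measurable_wrt (G k.+1) (s i k) /\
     rV_measurable_wrt (G k.+1) (w i k)) ->
  (forall j k, j \in Byz -> rV_measurable_wrt (G k.+1) (t j k)) ->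
  (forall i k omega, i \in Reg ->
     is_subgradient (fun u => lpnorm p (u - x0 k omega))
                    (x i k omega) (s i k omega)) ->
  (forall i k omega, i \in Reg ->
     is_subgradient (fun u => lpnorm p (u - x i k omega))
                    (x0 k omega) (w i k omega)) ->
  (forall k omega,
     is_stack_subgradient Reg p (fun i => x i k omega) (x0 k omega)
                          (fun i => s i k omega) (fun i => w i k omega)) ->
  (forall j k omega, j \in Byz ->
     is_subgradient (fun u => lpnorm p (u - z j k omega))
                    (x0 k omega) (t j k omega)) ->
  (forall i k omega, i \in Reg ->
     x i k.+1 omega =
       x i k omega
       - alpha k.+1 *: (gradient (F^~ (xi i k omega)) (x i k omega)
                        + lambda *: s i k omega)) ->
  (forall k omega,
     x0 k.+1 omega =
       x0 k omega
       - alpha k.+1 *: (gradient f0 (x0 k omega)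
                        + lambda *: (\sum_(i in Reg) w i k omega
                                     + \sum_(j in Byz) t j k omega))) ->
  0 < epsilon < 2 * mu0 * L0 / (mu0 + L0) ->
  1 / eta < alpha_bar ->
  alpha_bar / k0.+1%:R <= alpha_low ->
  (forall k : nat, alpha_bar / k.+1%:R <= alpha_low -> (k0 <= k)%N) ->
  (lambda0 <= lambda ->
     forall k, (k0 <= k)%N ->
       (err k <= Delta1 / k.+1%:R%:E + (alpha_bar * Delta2)%:E)%E)
  /\
  (lambda < lambda0 ->
     forall Delta3 : R,
       stack_sqdist Reg xs xs0 (fun=> xt) xt <= Delta3 ->
     forall k, (k0 <= k)%N ->
       (err k <= 2%:E * Delta1 / k.+1%:R%:E + (2 * alpha_bar * Delta2)%:E
                 + (2 * Delta3)%:E)%E).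
Proof.
move=> Reg r q f eta alpha_low alpha Delta0 Delta2 Delta1 lambda0 err.
move=> p1 pb lam0 iF dF mu_gt0 mu0_gt0 cf cf0 fL f0L [sG GO GG] iid vF.
move=> xtmin xsmin mxi mx0 msw mt ss sw sst st xrec x0rec /andP[eps0 eps1].
move=> etaab k0a k0min.
have lam00 := ltW lam0.
(* Source of the positivity of the Lipschitz constants. *)
have muL i : mu i <= L i.
  exact: strongly_convex_le_lipschitz d_gt0 (mu_gt0 i) (cf i) (fL i).
have muL0 : mu0 <= L0 by exact: strongly_convex_le_lipschitz d_gt0 mu0_gt0 cf0 f0L.
have L_gt0 i : 0 < L i by exact: lt_le_trans (muL i).
have L0_gt0 : 0 < L0 by exact: lt_le_trans muL0.
have c_gt0 i : 0 < mu i + L i by rewrite addr_gt0.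
have c0_gt0 : 0 < mu0 + L0 by rewrite addr_gt0.
have etai i : i \in Reg -> eta <= 2 * mu i * L i / (mu i + L i).
  by move=> iR; exact: bigmin_le_cond.
have eta0 : eta + epsilon <= 2 * mu0 * L0 / (mu0 + L0).
  by rewrite -lerBrDr; exact: bigmin_le_id.
have eta_gt0 : 0 < eta.
  apply: lt_bigmin => [|i _]; first by rewrite subr_gt0.
  by rewrite divr_gt0// !mulr_gt0.
have al_gt0 : 0 < alpha_low.
  by apply: lt_bigmin => [|i _]; rewrite divr_gt0// mulr_gt0.
have ali i : i \in Reg -> alpha_low * (2 * (mu i + L i)) <= 1.
  by move=> iR; rewrite -ler_pdivlMr ?mulr_gt0//; exact: bigmin_le_cond.
have al0 : alpha_low * (2 * (mu0 + L0)) <= 1.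
  by rewrite -ler_pdivlMr ?mulr_gt0//; exact: bigmin_le_id.
clearbody eta alpha_low.
have ab_gt0 : 0 < alpha_bar by apply: lt_trans etaab; rewrite divr_gt0.
have eab : 1 < eta * alpha_bar by rewrite mulrC -ltr_pdivrMr.
have alphaE k : (k0 <= k)%N -> alpha k.+1 = alpha_bar / k.+1%:R.
  move=> kk; rewrite /alpha min_r// (le_trans _ k0a)// ler_pM2l//.
  by rewrite lef_pV2 ?posrE ?ltr0n// ler_nat.
have alpha_ge0 k : 0 <= alpha k.+1.
  by rewrite le_min (ltW al_gt0) divr_ge0// ltW.
have alpha_le c k : 0 < c -> alpha_low * (2 * c) <= 1 -> alpha k.+1 * (2 * c) <= 1.
  move=> c0; apply: le_trans; rewrite ler_pM2r ?mulr_gt0//.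
  by rewrite ge_min lexx.
(* The contraction factor is nonnegative because [2 mu0 L0 / (mu0 + L0) <= 2 (mu0 + L0)]. *)
have aleta k : alpha k.+1 * eta <= 1.
  apply: le_trans (alpha_le _ k c0_gt0 al0); rewrite ler_wpM2l//.
  have h : eta <= 2 * mu0 * L0 / (mu0 + L0) by lra.
  apply: (le_trans h); rewrite ler_pdivrMr//.
  have h1 := mulr_gt0 mu0_gt0 L0_gt0.
  have h2 := sqr_ge0 mu0; have h3 := sqr_ge0 L0.
  have -> : 2 * (mu0 + L0) * (mu0 + L0) = 2 * mu0 ^+ 2 + 2 * L0 ^+ 2 + 4 * (mu0 * L0) by ring.
  by rewrite -mulrA; lra.
have dfi i u : differentiable (f i) u by have [+ _] := fL i; exact.
have df0 u : differentiable f0 u by have [+ _] := f0L; exact.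
have adap k : (forall i, i \in Reg -> rV_measurable_wrt (G k) (x i k)) /\
    rV_measurable_wrt (G k) (x0 k).
  elim: k => [//|k [IHi IH0]]; split=> [i iR|].
    have -> : x i k.+1 = fun omega => x i k omega - alpha k.+1 *:
        (gradient (F^~ (xi i k omega)) (x i k omega) + lambda *: s i k omega).
      by apply/funext => omega; exact: xrec.
    have [mX _ _] := iid i k; have [ms _] := msw i k iR.
    apply: (rV_measurable_wrtB (sG _) (rV_measurable_wrtW (GG k) (IHi i iR))).
    apply: (rV_measurable_wrtZ (sG _)); apply: (rV_measurable_wrtD (sG _)).
      move=> j.
      exact: (sampled_gradient_measurable (iF i) dF (sG k) (sG k.+1) (GG k) mX (IHi i iR)).
    exact: (rV_measurable_wrtZ (sG _)).
  have -> : x0 k.+1 = fun omega => x0 k omega - alpha k.+1 *: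
      (gradient f0 (x0 k omega) + lambda *: (\sum_(i in Reg) w i k omega
         + \sum_(j in Byz) t j k omega)).
    by apply/funext => omega; exact: x0rec.
  have IH0' := rV_measurable_wrtW (GG k) IH0.
  apply: (rV_measurable_wrtB (sG _) IH0').
  apply: (rV_measurable_wrtZ (sG _)); apply: (rV_measurable_wrtD (sG _)).
    exact: (rV_measurable_wrt_gradient (sG _) df0).
  apply: (rV_measurable_wrtZ (sG _)); apply: (rV_measurable_wrtD (sG _)).
    by apply: (rV_measurable_wrt_sum (sG _)) => i iR; have [] := msw i k iR.
  by apply: (rV_measurable_wrt_sum (sG _)) => j jB; exact: mt.
have adapO k : (forall i, i \in Reg -> rV_measurable_wrt measurable (x i k)) /\
    rV_measurable_wrt measurable (x0 k).
  have [h h0] := adap k; split=> [i iR|]; last exact: rV_measurable_wrtW (GO k) h0.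
  exact: rV_measurable_wrtW (GO k) (h i iR).
pose V k omega := stack_sqdist Reg (fun i => x i k omega) (x0 k omega) xs xs0.
have mV k : measurable_fun setT (V k).
  by have [h h0] := adapO k; exact: (measurable_stack_sqdist h h0).
have V0 k omega : 0 <= V k omega by exact: stack_sqdist_ge0.
pose n i k omega := noise (D i) F (xi i k) (x i k) omega.
have step k omega : V k.+1 omega <= (1 - alpha k.+1 * eta) * V k omega
    + (alpha k.+1 ^+ 2 * (4 * r * (4 * lambda ^+ 2 * d%:R)
         + 4 * (4 * lambda ^+ 2 * r ^+ 2 * d%:R) + 2 * (lambda ^+ 2 * q ^+ 2 * d%:R))
       + alpha k.+1 * Delta2)
    + \sum_(i in Reg) (2 * alpha k.+1 ^+ 2 * dotp (n i k omega) (n i k omega)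
        - 2 * alpha k.+1 * dotp (n i k omega) (x i k omega - xs i)).
  rewrite /V !stack_sqdistE.
  under eq_bigr => i iR.
    rewrite (xrec i k omega iR) (regular_step_split _ _ _ (gradient (f i) (x i k omega))
      (gradient (f i) (xs i))).
    over.
  rewrite x0rec (master_step_split _ _ _ (gradient f0 xs0)) [X in _ <= X + _]addrA.
  apply: (@stack_step_le _ _ _ Reg mu L mu0 L0 (alpha k.+1) eta epsilon
    (4 * lambda ^+ 2 * d%:R) (4 * lambda ^+ 2 * r ^+ 2 * d%:R)
    (lambda ^+ 2 * q ^+ 2 * d%:R) (fun i => x i k omega - xs i)
    (fun i => gradient (f i) (x i k omega) - gradient (f i) (xs i))
    (fun i => lambda *: s i k omega + gradient (f i) (xs i)) (fun i => n i k omega)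
    (x0 k omega - xs0) (gradient f0 (x0 k omega) - gradient f0 xs0)
    (lambda *: (\sum_(i in Reg) w i k omega) + gradient f0 xs0)
    (lambda *: (\sum_(j in Byz) t j k omega)) (alpha_ge0 k) eps0).
  - move=> i iR; split; [exact: c_gt0|exact: alpha_le (ali i iR)|exact: etai|].
    exact: gradient_cocoercive d_gt0 (mu_gt0 i) (cf i) (fL i).
  (* One [lambda] from the penalty subgradient, one from the gradient of the local cost at the
     minimizer. *)
  - move=> i iR; have -> : 4 * lambda ^+ 2 * d%:R = (2 * lambda) ^+ 2 * d%:R by ring.
    apply: dotp_le_coord => j.
    apply: (coord_scaleD_le (a := 1) (b := lambda) lam00); last by ring.
      exact: (lpnorm_subgradient_le1 j p1 (ss i k omega iR)).
    exact: (consensus_gradient_le p1 lam0 dfi df0 xsmin).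
  - split; [exact: c0_gt0|exact: alpha_le al0|exact: eta0|].
    exact: gradient_cocoercive d_gt0 mu0_gt0 cf0 f0L.
  - have -> : 4 * lambda ^+ 2 * r ^+ 2 * d%:R = (2 * lambda * r) ^+ 2 * d%:R by ring.
    apply: dotp_le_coord => j.
    apply: (coord_scaleD_le (a := r) (b := lambda * r) lam00); last by ring.
      apply: coord_sum_le => i iR.
      exact: (lpnorm_subgradient_le1 j p1 (sw i k omega iR)).
    exact: (consensus_gradient0_le p1 lam0 dfi df0 xsmin).
  (* Whatever [z] is sent, each Byzantine worker contributes coordinates of size at most one. *)
  - have -> : lambda ^+ 2 * q ^+ 2 * d%:R = (lambda * q) ^+ 2 * d%:R by ring.
    apply: dotp_le_coord => j; rewrite mxE normrM (ger0_norm lam00) ler_wpM2l//.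
    apply: coord_sum_le => i iB.
    exact: (lpnorm_subgradient_le1 j p1 (st i k omega iB)).
  - exact: (consensus_monotone p1 lam0 dfi df0 xsmin (sst k omega)).
pose E k := \int[P]_omega V k omega.
have D00 : 0 <= Delta0.
  have sd : 0 <= \sum_(i in Reg) delta i ^+ 2 by apply: sumr_ge0 => i _; exact: sqr_ge0.
  by rewrite /Delta0 !addr_ge0 ?mulr_ge0 ?sqr_ge0 ?ler0n.
have D20 : 0 <= Delta2.
  by rewrite /Delta2 divr_ge0 ?(ltW eps0) ?mulr_ge0 ?sqr_ge0.
have estep k : P.-integrable setT (EFin \o V k) ->
    P.-integrable setT (EFin \o V k.+1) /\
    E k.+1 <= (1 - alpha k.+1 * eta) * E k + alpha k.+1 ^+ 2 * Delta0
      + alpha k.+1 * Delta2.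
  move=> iV; have [hx _] := adap k.
  have ix i : i \in Reg -> P.-integrable setT
      (fun omega => (dotp (x i k omega - xs i) (x i k omega - xs i))%:E).
    move=> iR; apply: (le_integrable measurableT _ _ iV).
      by apply/measurable_EFinP; apply: measurable_sqdist; have [h _] := adapO k; exact: h.
    move=> omega _; rewrite /= lee_fin !ger0_norm ?dotp_ge0//.
    rewrite /V stack_sqdistE (bigD1 i iR)/= -addrA lerDl addr_ge0 ?dotp_ge0//.
    by apply: sumr_ge0 => j _; exact: dotp_ge0.
  have hn i := iid i k.
  have [||||iV' hE] := @expectation_step _ _ _ P _ Reg (V k) (V k.+1)
    (fun i omega => dotp (n i k omega) (n i k omega))
    (fun i omega => dotp (n i k omega) (x i k omega - xs i)) delta _ _ _
    iV (mV k.+1) (V0 k.+1) _ _ _ _ (step k).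
  - move=> i iR; have [mX lX indX] := hn i.
    exact: (integrable_noise_sqr (iF i) dF (fL i) (vF i) (sG k) (GO k) (GO k.+1)
      mX lX indX (hx i iR)).
  - move=> i iR; have [mX lX indX] := hn i.
    exact: (expectation_noise_sqr (iF i) dF (fL i) (vF i) (sG k) (GO k) (GO k.+1)
      mX lX indX (hx i iR)).
  - move=> i iR; have [mX lX indX] := hn i.
    exact: (integrable_noise_dotp (iF i) dF (fL i) (vF i) (sG k) (GO k) (GO k.+1)
      mX lX indX (hx i iR) (ix i iR)).
  - move=> i iR; have [mX lX indX] := hn i.
    exact: (expectation_noise_dotp (iF i) dF (fL i) (vF i) (sG k) (GO k) (GO k.+1)
      mX lX indX (hx i iR) (ix i iR)).
  split=> //; apply: (le_trans hE).
  by rewrite le_eqVlt; apply/orP; left; apply/eqP; rewrite /Delta0 /E; ring.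
have EV k : P.-integrable setT (EFin \o V k) -> ('E_P[V k] = (E k)%:E)%E.
  by move=> iV; rewrite unlock /E /Rintegral fineK//; exact: integrable_fin_num iV.
have main k : (k0 <= k)%N ->
    ('E_P[V k] <= Delta1 / k.+1%:R%:E + (alpha_bar * Delta2)%:E)%E.
  move=> kk.
  (* An infinite mean at [k0] makes [Delta1] infinite; a finite one gives integrability from [k0]
     on. *)
  have [/eqP Vinf|Vfin] := eqVneq ('E_P[V k0])%E +oo%E.
    suff -> : Delta1 = +oo%E.
      by rewrite inver gt_eqF ?ltr0n// gt0_mulye ?lte_fin ?invr_gt0// leey.
    rewrite /Delta1 (_ : ('E_P[_])%E = +oo%E); last exact/eqP.
    by rewrite gt0_muley ?lte_fin ?ltr0n// maxey.
  have iV0 : P.-integrable setT (EFin \o V k0).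
    apply/integrableP; split; first exact/measurable_EFinP.
    rewrite ltey; move: Vfin; rewrite unlock; congr (_ != _).
    by apply: eq_integral => omega _ /=; rewrite ger0_norm.
  have iV j : (k0 <= j)%N -> P.-integrable setT (EFin \o V j).
    elim: j => [|j IH]; first by rewrite leqn0 => /eqP <-.
    by rewrite leq_eqVlt => /predU1P[<-//|]; rewrite ltnS => /IH/estep[].
  pose D1 := Num.max (alpha_bar ^+ 2 * Delta0 / (eta * alpha_bar - 1))
    (k0.+1%:R * E k0 + alpha_bar ^+ 2 * Delta0 / k0.+1%:R).
  have -> : Delta1 = D1%:E.
    by rewrite /Delta1 (EV k0 iV0) -EFinM -EFinD /D1 EFin_max.
  rewrite (EV k (iV k kk)) inver gt_eqF ?ltr0n// -EFinM -EFinD lee_fin.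
  apply: (@step_size_recursion _ E k0 alpha_bar eta Delta0 D1 Delta2) => //.
  - by move=> j kj; rewrite -alphaE.
  - by move=> j kj; have [_] := estep j (iV j kj); rewrite alphaE.
  - by rewrite /D1 le_max lexx.
  - rewrite ler_pdivlMr ?ltr0n// /D1 le_max mulrC lerDl; apply/orP; right.
    by rewrite divr_ge0// mulr_ge0// sqr_ge0.
split=> [lam_ge k kk|lam_lt Delta3 hD3 k kk].
  (* The penalty is exact in this regime, so the error is [V k] itself and the bound holds from [k0]
     on. *)
  have hb i : i \in Reg -> lpnorm b (gradient (f i) xt) <= lambda.
    by move=> iR; apply: le_trans lam_ge; exact: le_bigmax_cond.
  have [xsE xs0E] := consensus_minimizer_unique p1 dfi df0 pb mu_gt0 mu0_gt0
    cf cf0 xtmin hb xsmin.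
  apply: le_trans (main k kk); rewrite le_eqVlt; apply/orP; left; apply/eqP.
  congr ('E_P[ _ ])%E; apply/funext => omega; rewrite /V /stack_sqdist xs0E.
  by congr (_ + _); apply: eq_bigr => i iR; rewrite xsE.
(* Pass through the penalized minimizer, at the price of a factor 2. *)
have hsq omega : stack_sqdist Reg (fun i => x i k omega) (x0 k omega) (fun=> xt) xt
    <= 2 * V k omega + 2 * Delta3.
  apply: (@le_trans _ _ (2 * V k omega + 2 * stack_sqdist Reg xs xs0 (fun=> xt) xt)).
    rewrite /V !stack_sqdistE !mulrDr addrACA.
    have h (a c e : 'rV[R]_d) : dotp (a - e) (a - e) <=
        2 * dotp (a - c) (a - c) + 2 * dotp (c - e) (c - e).
      have -> : a - e = (a - c) + (c - e) by rewrite addrA subrK.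
      exact: dotp_sqrD.
    apply: lerD; last exact: h.
    by rewrite !mulr_sumr -big_split; apply: ler_sum => i _; exact: h.
  by rewrite lerD2l ler_pM2l.
have [hx hx0] := adapO k.
apply: (@le_trans _ _ (2%:E * 'E_P[V k] + (2 * Delta3)%:E)%E).
  rewrite /err unlock -ge0_integralZl_EFin//; last 2 first.
  - by move=> omega _; rewrite lee_fin.
  - exact/measurable_EFinP.
  have D30 : 0 <= Delta3 by apply: le_trans hD3; exact: stack_sqdist_ge0.
  have -> : ((2 * Delta3)%:E = \int[P]_omega (2 * Delta3)%:E)%E.
    by rewrite integral_cst//= probability_setT mule1.
  rewrite -ge0_integralD//; last 3 first.
  - by move=> omega _; rewrite mule_ge0// lee_fin.
  - by apply: measurable_funeM; exact/measurable_EFinP.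
  - by move=> omega _; rewrite lee_fin mulr_ge0.
  apply: ge0_le_integral => //.
  - by move=> omega _; rewrite lee_fin stack_sqdist_ge0.
  - apply/measurable_EFinP; exact: (measurable_stack_sqdist hx hx0).
  - apply: emeasurable_funD; last exact: measurable_cst.
    by apply: measurable_funeM; exact/measurable_EFinP.
  - by move=> omega _; rewrite -EFinM -EFinD lee_fin.
have two : (0 <= 2%:E :> \bar R)%E by rewrite lee_fin.
rewrite leeD2rE//; apply: le_trans (lee_wpmul2l two (main k kk)) _.
rewrite le_eqVlt; apply/orP; left; apply/eqP.
(* [Delta1] may be infinite; distributing is sound because the other summand is finite. *)
rewrite muleDr//; last by rewrite fin_num_adde_defl.
by rewrite muleA -EFinM mulrA.
Qed.
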